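(* Let $n\ge 1$. Let $D_n$ be the knot diagram in $S^2$ given by the standard closure of the 2-strand braid $\sigma_1^{-(n+1)}\sigma_1^{n}$ (a row of $2n+1$ crossings between two parallel, identically oriented strands, the first $n+1$ negative and the following $n$ positive), and let $E_n$ be obtained from $D_n$ by reversing the middle crossing (so $E_n$ has $n$ negative crossings followed by $n+1$ positive ones; $E_n$ is the mirror image of $D_n$). Both are diagrams of the unknot. Then the minimal number of Reidemeister moves needed to pass from $D_n$ to $E_n$ is exactly $2n+2$. Moreover, any sequence of $2n+2$ Reidemeister moves from $D_n$ to $E_n$ contains exactly two RI moves, and each of the other $2n$ moves changes $I_{lk}$ by one of the four elements $X_0+Y_1$, $-(X_{-1}+Y_0)$, $X_0-X_{-1}$, $Y_1-Y_0$; in particular no unmatched RII move occurs in such a sequence.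
   Context: Knot diagrams are generic oriented immersed circles in $S^2$ with over/under information at each crossing, up to isotopy of $S^2$; Reidemeister moves RI, RII, RIII are the usual local moves. An RII move is matched if the two strands involved are identically oriented and unmatched if they are oppositely oriented. For a crossing $a$ of $D$, the smoothing $D^a$ is the ordered oriented two-component link obtained by the orientation-preserving cut-and-paste at $a$, its first component being the one entering a neighborhood of $a$ along the overcrossing arc and leaving along the undercrossing arc. Crossing signs are given by the right-hand rule; $D_\pm$ are the positive/negative crossings. $\mathbb{G}_{\mathbb{Z}}$ is the free abelian group with basis $\{X_n,Y_n\}_{n\in\mathbb{Z}}$ and $I_{lk}(D)=\sum_{a\in D_+}X_{lk(D^a)}+\sum_{a\in D_-}Y_{lk(D^a)}$, where $lk$ is the linking number of the two components. (For these diagrams $I_{lk}(D_n)=(n+1)Y_0+nX_{-1}$ and $I_{lk}(E_n)=(n+1)X_0+nY_1$.) *)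

(* Defs.v *)
From HB Require Import structures.
From mathcomp Require Import all_boot all_order all_algebra.
Set Implicit Arguments. Unset Strict Implicit. Unset Printing Implicit Defensive.
Import Order.TTheory GRing.Theory Num.Theory.

(* A (raw) signed Gauss code: the cyclic word of passages met while travelling
   along the oriented curve; a letter (c, true) is an over-passage at crossing
   c, (c, false) an under-passage.  gsgn c = true iff crossing c is positive
   (right-hand rule). *)
Record gcode := GCode { gword : seq (nat * bool); gsgn : nat -> bool }.

Definition gN (D : gcode) : nat := size (gword D).
Definition lett (D : gcode) (i : nat) : nat * bool := nth (0, false) (gword D) i.
Definition crossings (D : gcode) : seq nat := undup (map fst (gword D)).
Definition ncross (D : gcode) : nat := size (crossings D).

Definition wf (D : gcode) : bool :=
  uniq (gword D) && all (fun l => (l.1, ~~ l.2) \in gword D) (gword D).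

(* ---- the ribbon graph (rotation system) of the diagram ----
   Darts are encoded as naturals d < 2 * gN D: occurrence i = d./2, and
   odd d = true for the end of edge i leaving occurrence i, odd d = false for
   the end of edge i-1 arriving at occurrence i (edge i joins occurrence i to
   occurrence i+1 mod gN D).  At a crossing the four darts sit at positions
   0,1,2,3 in counterclockwise order: under-in = 0, under-out = 2, and the
   over strand enters at 3 and leaves at 1 iff the crossing is positive. *)
Definition partner (D : gcode) (i : nat) : nat :=
  index ((lett D i).1, ~~ (lett D i).2) (gword D).

Definition dpos (D : gcode) (i : nat) (out : bool) : nat :=
  let l := lett D i in
  if l.2 then (if gsgn D l.1 then (if out then 1 else 3) else (if out then 3 else 1))
  else (if out then 2 else 0).

Definition sigma (D : gcode) (d : nat) : nat :=
  let i := d./2 in let out := odd d in let j := partner D i in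
  let q := (dpos D i out).+1 %% 4 in
  if dpos D i (~~ out) == q then i.*2 + ~~ out
  else if dpos D j false == q then j.*2 else j.*2.+1.

Definition alpha (D : gcode) (d : nat) : nat :=
  let i := d./2 in let N := gN D in
  if odd d then (i.+1 %% N).*2 else ((i + N).-1 %% N).*2.+1.

(* face permutation: its orbits are the faces (complementary regions) *)
Definition phi (D : gcode) (d : nat) : nat := sigma D (alpha D d).

Definition edge_of (D : gcode) (d : nat) : nat :=
  let i := d./2 in if odd d then i else (i + gN D).-1 %% gN D.

Definition face_len (D : gcode) (d : nat) : nat :=
  (find (fun k => iter k.+1 (phi D) d == d) (iota 0 (gN D).*2)).+1.

(* number of faces = number of phi-orbits (counted by their least dart) *)
Definition nfaces (D : gcode) : nat :=
  count (fun d => all (fun k => d <= iter k (phi D) d) (iota 0 (gN D).*2))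
        (iota 0 (gN D).*2).

(* genus 0: V - E + F = 2 (the graph is connected, being one closed curve);
   the empty word is the crossingless round circle *)
Definition planar (D : gcode) : bool :=
  (gN D == 0) || (nfaces D == ncross D + 2).

Definition is_diagram (D : gcode) : bool := wf D && planar D.

(* isotopy of S^2 (= orientation-preserving homeomorphism): relabelling of
   crossings and change of base point of the Gauss word, preserving signs *)
Definition iso (D E : gcode) : Prop :=
  exists (f : nat -> nat) (k : nat),
    gword E = rot k [seq (f l.1, l.2) | l <- gword D] /\
    (forall c, c \in crossings D -> gsgn E (f c) = gsgn D c).

Definition bigon_face (D : gcode) (e1 e2 : nat) : Prop :=
  exists d, d < (gN D).*2 /\ face_len D d = 2 /\
    edge_of D d = e1 /\ edge_of D (phi D d) = e2.

Definition tri_face (D : gcode) (e1 e2 e3 : nat) : Prop :=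
  exists d, d < (gN D).*2 /\ face_len D d = 3 /\ edge_of D d = e1 /\
    ((edge_of D (phi D d) = e2 /\ edge_of D (phi D (phi D d)) = e3) \/
     (edge_of D (phi D d) = e3 /\ edge_of D (phi D (phi D d)) = e2)).

Inductive mkind := RI | RIIm | RIIu | RIII.

Definition isRI (k : mkind) : bool := if k is RI then true else false.
Definition isRIIu (k : mkind) : bool := if k is RIIu then true else false.

(* [del k D E]: E is obtained from D by a move of kind k which (for RI, RII)
   removes crossings; the moved region is placed at the start of the word
   (arbitrary position is recovered through [iso]).
   RI  : a kink (two consecutive passages through the same crossing).
   RII : a bigon face whose two crossings a <> b are both passed over by the
         same edge; matched iff both bigon edges run from a to b.
   RIII: a triangular face with three distinct crossings, one of whose edges
         is over at both ends; the move reverses the order of the two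
         passages on each of the three edges (signs unchanged). *)
Definition del (k : mkind) (D E : gcode) : Prop :=
  gsgn E = gsgn D /\
  match k with
  | RI => exists c b s, gword D = [:: (c, b), (c, ~~ b) & s] /\ gword E = s
  | RIIm => exists a b s1 s2, a != b /\
      gword D = [:: (a, true); (b, true)] ++ s1 ++ [:: (a, false); (b, false)] ++ s2 /\
      gword E = s1 ++ s2 /\ bigon_face D 0 (size s1).+2
  | RIIu => exists a b s1 s2, a != b /\
      gword D = [:: (a, true); (b, true)] ++ s1 ++ [:: (b, false); (a, false)] ++ s2 /\
      gword E = s1 ++ s2 /\ bigon_face D 0 (size s1).+2
  | RIII => exists l1 l2 l3 l4 l5 l6 s1 s2 s3,
      gword D = [:: l1; l2] ++ s1 ++ [:: l3; l4] ++ s2 ++ [:: l5; l6] ++ s3 /\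
      gword E = [:: l2; l1] ++ s1 ++ [:: l4; l3] ++ s2 ++ [:: l6; l5] ++ s3 /\
      l1.2 && l2.2 /\
      size (undup [:: l1.1; l2.1; l3.1; l4.1; l5.1; l6.1]) = 3 /\
      tri_face D 0 (size s1).+2 (size s1 + size s2).+4
  end.

Definition step (k : mkind) (D E : gcode) : Prop :=
  exists D1 E1, iso D D1 /\ iso E E1 /\ is_diagram D1 /\ is_diagram E1 /\
    (del k D1 E1 \/ del k E1 D1).

Fixpoint steps_ok (P : mkind -> gcode -> gcode -> Prop) (D : gcode)
    (s : seq (mkind * gcode)) : Prop :=
  match s with
  | [::] => True
  | (k, G) :: s' => P k D G /\ steps_ok P G s'
  end.

Definition rpath (D : gcode) (s : seq (mkind * gcode)) : Prop :=
  steps_ok (fun k D G => is_diagram G /\ step k D G) D s.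

Definition rend (D : gcode) (s : seq (mkind * gcode)) : gcode :=
  last D (map snd s).

Local Open Scope ring_scope.

Definition sgnz (b : bool) : int := if b then 1 else -1.

(* linking number of the smoothing D^a: sum of the signs of the crossings
   where the first component (from the under-passage of a to the
   over-passage of a) passes over the second one *)
Definition lk (D : gcode) (a : nat) : int :=
  let w := gword D in
  let r := rot (index (a, false) w).+1 w in
  \sum_(c <- crossings D | c != a)
     (if ((index (c, true) r < index (a, true) r) &&
          (index (a, true) r < index (c, false) r))%N
      then sgnz (gsgn D c) else 0).

(* elements of G_Z as coefficient functions: (true, m) <-> X_m,
   (false, m) <-> Y_m *)
Definition GZ := bool -> int -> int.
Definition gbas (b0 : bool) (m0 : int) : GZ :=
  fun b m => if (b == b0) && (m == m0) then 1 else 0.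
Definition gadd (f g : GZ) : GZ := fun b m => f b m + g b m.
Definition gopp (f : GZ) : GZ := fun b m => - f b m.

Definition Ilk (D : gcode) : GZ :=
  fun b m => (count (fun c => (gsgn D c == b) && (lk D c == m)) (crossings D))%:Z.

Definition Xg := gbas true.
Definition Yg := gbas false.

Definition ilk_change_ok (D E : gcode) : Prop :=
  exists g : GZ,
    (g = gadd (Xg 0) (Yg 1) \/ g = gopp (gadd (Xg (-1)) (Yg 0)) \/
     g = gadd (Xg 0) (gopp (Xg (-1))) \/ g = gadd (Yg 1) (gopp (Yg 0))) /\
    forall b m, Ilk E b m - Ilk D b m = g b m.

Local Close Scope ring_scope.

(* ---- the diagrams D_n and E_n ----
   crossings 1..2n+1 along the braid, 1..n+1 negative, n+2..2n+1 positive;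
   the walk starts at the bottom-left of the braid; at odd crossings it goes
   left-to-right (over iff positive), at even ones right-to-left. *)
Definition Dsgn (n i : nat) : bool := n.+1 < i.
Definition Dover1 (n i : nat) : bool := odd i == Dsgn n i.

Definition Dn (n : nat) : gcode :=
  GCode ([seq (i, Dover1 n i) | i <- iota 1 (n.*2.+1)] ++
         [seq (i, ~~ Dover1 n i) | i <- iota 1 (n.*2.+1)])
        (Dsgn n).

Definition En (n : nat) : gcode :=
  GCode [seq (l.1, if l.1 == n.+1 then ~~ l.2 else l.2) | l <- gword (Dn n)]
        (fun i => if i == n.+1 then ~~ Dsgn n i else Dsgn n i).

(* Main.v *)
Require Import Defs.
From mathcomp Require Import all_boot all_order all_algebra.
From mathcomp Require Import zify ring.
Set Implicit Arguments. Unset Strict Implicit. Unset Printing Implicit Defensive.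
Import Order.TTheory GRing.Theory Num.Theory.

(* Upper bound: a matched RII move cancels the two middle crossings of D_n and
   yields D_(n-1); after n of them one RI move gives the round circle, and the
   reverse process, with the opposite kink, builds E_n.

   Lower bound: for a weight h, let w_h(D) be the sum of h (sgn c) (lk D^c) over
   the crossings c.  A move changes I_lk by +-X_0 or +-Y_0 (RI),
   +-(X_m + Y_(m+1)) (matched RII), +-(X_m + Y_m) (unmatched RII) or
   +-(X_(m+1) - X_m), +-(Y_(m+1) - Y_m) (RIII).  Two weights with values in
   {-1, 0, 1} grow by at most 1 under each move and by 2n+2 from D_n to E_n, so
   that in a shortest sequence both grow by exactly 1 at each move, which leaves
   only +X_0, -Y_0 and the four listed changes.  The writhe grows by 2 in total
   and only under the RI moves of such a sequence, whence their number. *)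

(** * Linking numbers of smoothings *)

(** The word [gword] alone does not determine the effect of an RII or RIII move: it depends on the
    signs at the corners of the bigon or triangle, and only the requirement that this region be a
    face constrains them. Two localities make the question finite. Whether a crossing counts in the
    smoothing at another one depends on the cyclic order of four letters, and the face permutation
    along a small face involves only the passages at its corners. Hence each move is settled by
    computation on a word with two or three crossings, whose labels are then replaced by the actual
    ones. Both weights take the value 1 on $X_0$, -1 on $Y_0$ and 0 on $X_{-1}$ and $Y_1$, which
    gives -(n+1) on $D_n$ and n+1 on $E_n$. Each RI move of a tight sequence creates a positive kink
    or removes a negative one, so it raises the writhe by exactly 1. *)

Notation letter := (nat * bool)%type.

(** The test in [lk], isolated because it sees only the cyclic order of the four letters of [a] and
    [d]. *)
Definition pat (w : seq letter) (a d : nat) : bool :=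
  let r := rot (index (a, false) w).+1 w in
  (index (d, true) r < index (a, true) r) &&
  (index (a, true) r < index (d, false) r).

Section IndexRot.
Variable T : eqType.
Implicit Types (s : seq T) (x y : T).

Lemma ltn_index_filter (P : pred T) s x y : P x -> P y ->
  (index x (filter P s) < index y (filter P s)) = (index x s < index y s).
Proof.
move=> Px Py; elim: s => //= z s IH.
case: ifP => Pz /=; first by do 2 case: eqP => //= _.
by case: eqP Pz => [->|_]; [rewrite Px | case: eqP => [->|//]; rewrite Py].
Qed.

Lemma index_map_in (T' : eqType) (f : T -> T') s x :
  {in x :: s &, injective f} -> index (f x) (map f s) = index x s.
Proof.
elim: s => //= y s IH inj; rewrite IH; last first.
  by move=> u v; rewrite !inE => /orP[]uP /orP[]vP; apply: inj;
     rewrite !inE ?uP ?vP ?orbT.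
by rewrite (inj_in_eq inj) ?inE ?eqxx ?orbT.
Qed.

Lemma rot_after s1 s2 x : x \notin s1 ->
  rot (index x (s1 ++ x :: s2)).+1 (s1 ++ x :: s2) = s2 ++ rcons s1 x.
Proof.
move=> xs1; rewrite index_cat (negbTE xs1) /= eqxx addn0.
by rewrite -cat_rcons -(size_rcons s1 x) rot_size_cat.
Qed.

Lemma mem_cat_split s x : x \in s ->
  exists s1 s2, s = s1 ++ x :: s2 /\ x \notin s1.
Proof.
elim: s => //= y s IH; rewrite inE; case: eqVneq => [<- _|xy /= /IH]; first by exists [::], s.
by case=> s1 [s2 [-> xs1]]; exists (y :: s1), s2; rewrite inE (negbTE xy).
Qed.

(** Base-point independence of [pat] rests on this: a cyclic word cut just after a given letter no
    longer depends on where it started. *)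
Lemma rot_after_rot s k x : uniq s -> x \in s ->
  rot (index x (rot k s)).+1 (rot k s) = rot (index x s).+1 s.
Proof.
move=> us xs.
(* A rotation exchanges the blocks [take k s] and [drop k s]. *)
suff rot_cat t u : uniq (t ++ u) -> x \in t ++ u ->
    rot (index x (u ++ t)).+1 (u ++ t) = rot (index x (t ++ u)).+1 (t ++ u).
  by rewrite -{3 4}(cat_take_drop k s) -rot_cat ?cat_take_drop.
have not_in (v v' : seq T) : uniq (v ++ x :: v') -> x \notin v.
  by rewrite cat_uniq /= negb_or => /and3P[_ /andP[]].
move=> ut; rewrite mem_cat => /orP[] /mem_cat_split[s1 [s2 [def xs1]]];
  move: ut; rewrite {}def.
  rewrite uniq_catC catA => /not_in xus1.
  by rewrite (rot_after _ xus1) -catA cat_cons rot_after // rcons_cat catA.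
rewrite catA => /not_in xts1; rewrite (rot_after _ xts1) -catA cat_cons rot_after //.
by rewrite rcons_cat catA.
Qed.
End IndexRot.

(** Locality: discarding letters of other crossings keeps the relative order of the four that
    matter. *)
Lemma pat_filter (P : pred letter) w a d :
    P (a, true) -> P (a, false) -> P (d, true) -> P (d, false) ->
  pat (filter P w) a d = pat w a d.
Proof.
move=> Pa Pa' Pd Pd'.
suff E : rot (index (a, false) (filter P w)).+1 (filter P w) =
         filter P (rot (index (a, false) w).+1 w).
  by rewrite /pat E !ltn_index_filter.
have [aw|aw] := boolP ((a, false) \in w); last first.
  (* When the letter is absent [index] returns the size, and both rotations are trivial. *)
  by rewrite !memNindex ?mem_filter ?(negbTE aw) ?andbF // !rot_oversize.
have [s1 [s2 [-> as1]]] := mem_cat_split aw.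
by rewrite rot_after // !filter_cat /= Pa' rot_after ?filter_rcons ?Pa' //
  mem_filter negb_and as1 orbT.
Qed.

Definition relabel (f : nat -> nat) (l : letter) : letter := (f l.1, l.2).

Lemma pat_map f w a d : {in a :: d :: map fst w &, injective f} ->
  pat (map (relabel f) w) (f a) (f d) = pat w a d.
Proof.
move=> inj.
have idx x b r : x \in [:: a; d] -> {subset r <= w} ->
    index (f x, b) (map (relabel f) r) = index (x, b) r.
  move=> xad rw; rewrite -[(f x, b)]/(relabel f (x, b)) index_map_in //.
  have mem l : l \in (x, b) :: r -> l.1 \in a :: d :: map fst w.
    rewrite inE => /predU1P[-> /=|/rw lw].
      by move: xad; rewrite !inE => /orP[]->; rewrite ?orbT.
    by rewrite !inE (map_f fst lw) !orbT.
  by move=> [i ib] [j jb] /mem /= iw /mem /= jw [/(inj _ _ iw jw) -> ->].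
have sub k : {subset rot k w <= w} by move=> l; rewrite mem_rot.
rewrite /pat (idx a false w) ?inE ?eqxx // -map_rot.
by rewrite !idx // !inE eqxx ?orbT.
Qed.

Lemma pat_rot w k a d : uniq w -> (a, false) \in w -> pat (rot k w) a d = pat w a d.
Proof. by move=> uw aw; rewrite /pat rot_after_rot. Qed.

Lemma wf_uniq D : wf D -> uniq (gword D).
Proof. by case/andP. Qed.

Lemma crossings_uniq D : uniq (crossings D).
Proof. exact: undup_uniq. Qed.

Lemma mem_crossings D c b : wf D -> ((c, b) \in gword D) = (c \in crossings D).
Proof.
case/andP=> _ /allP bar; rewrite mem_undup; apply/idP/mapP => [cb|[[c' b'] cb' /= ->]].
  by exists (c, b).
by case: (eqVneq b b') => [->//|]; have /= := bar _ cb'; case: b b' {cb'} => [] [].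
Qed.

Lemma mem_crossings_fst D l : l \in gword D -> l.1 \in crossings D.
Proof. by rewrite mem_undup; apply: map_f. Qed.

Local Open Scope ring_scope.

Definition lkterm (D : gcode) (a d : nat) : int :=
  if pat (gword D) a d then sgnz (gsgn D d) else 0.

Lemma lkE D a : lk D a = \sum_(d <- crossings D | d != a) lkterm D a d.
Proof. by []. Qed.

Definition wsum (h : bool -> int -> int) (D : gcode) : int :=
  \sum_(c <- crossings D) h (gsgn D c) (lk D c).

(** Each coefficient of $I_{lk}$ is itself a weighted sum, so a formula valid for all weights
    describes the change of $I_{lk}$. *)
Lemma Ilk_wsum D b m : Ilk D b m = wsum (fun e k => gbas b m e k) D.
Proof.
rewrite /Ilk /wsum -sum1_count (big_morph Posz PoszD (erefl _)) big_mkcond /=.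
by apply: eq_bigr => c _; rewrite /gbas; case: ifP.
Qed.

Lemma wsum_iso h D E : wf D -> wf E -> iso D E -> wsum h E = wsum h D.
Proof.
move=> wD wE [f [k [defE sgnE]]].
have uF : uniq (map (relabel f) (gword D)).
  by rewrite -(rot_uniq k) -defE wf_uniq.
(* [iso] does not ask that [f] be injective, but two crossings with the same image would repeat a
   letter in the word of [E]. *)
have inj : {in crossings D &, injective f}.
  move=> c d cD dD fcd; move: (cD) (dD); rewrite -!(mem_crossings _ true wD).
  move=> /(nthP (0, false)%N)[i iD ci] /(nthP (0, false)%N)[j jD dj].
  have : nth (0, false)%N (map (relabel f) (gword D)) i =
         nth (0, false)%N (map (relabel f) (gword D)) j.
    by rewrite !(nth_map (0, false)%N) // ci dj /relabel /= fcd.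
  move/eqP; rewrite nth_uniq ?size_map // => /eqP ij.
  by move: ci; rewrite ij dj => -[].
have perm : perm_eq (crossings E) (map f (crossings D)).
  apply: uniq_perm; rewrite ?crossings_uniq ?(map_inj_in_uniq inj) ?crossings_uniq //.
  move=> c; rewrite mem_undup defE map_rot mem_rot -map_comp.
  apply/mapP/mapP => -[].
    by move=> l lD -> /=; exists l.1; rewrite ?mem_crossings_fst.
  by move=> d; rewrite -(mem_crossings d true wD) => dD ->; exists (d, true).
have patE c d : c \in crossings D -> d \in crossings D ->
    pat (gword E) (f c) (f d) = pat (gword D) c d.
  move=> cD dD; rewrite defE pat_rot ?pat_map //.
    by apply: sub_in2 inj => x; rewrite !inE => /predU1P[->|/predU1P[->|]] //;
       rewrite -mem_undup.
  by apply/mapP; exists (c, false); rewrite ?mem_crossings.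
rewrite /wsum (perm_big _ perm) big_map big_seq [RHS]big_seq.
apply: eq_bigr => c cD; rewrite sgnE //; congr (h _ _).
rewrite !lkE (perm_big _ perm) big_map big_seq_cond [RHS]big_seq_cond.
apply: eq_big => d; last by case/andP=> dD _; rewrite /lkterm patE // sgnE.
by case: (boolP (d \in _)) => //= dD; rewrite (inj_in_eq inj).
Qed.

(** A crossing away from the move thus presents only two cases to the finite checks: over-passage
    first or under-passage first. *)
Lemma pair_filter D d : wf D -> d \in crossings D ->
  exists b, [seq l <- gword D | l.1 == d] = [:: (d, b); (d, ~~ b)].
Proof.
move=> wD dD; set s := filter _ _.
have : perm_eq s [:: (d, true); (d, false)].
  apply: uniq_perm; [by rewrite filter_uniq ?wf_uniq | by rewrite /= inE xpair_eqE andbF |].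
  move=> [c b].
  rewrite mem_filter /= mem_crossings // !inE !xpair_eqE.
  by case: eqVneq => //= ->; rewrite dD; case: b.
move=> p; have := perm_size p; case: s p => [|x [|y []]] // p _; exists x.2.
have := perm_mem p x; have := perm_mem p y; rewrite !inE !eqxx /=.
have : uniq [:: x; y] by rewrite (perm_uniq p) /= inE xpair_eqE andbF.
rewrite /= inE andbT; move: x y p => [x bx] [y b].
rewrite !xpair_eqE orbT; case: bx; case: b; rewrite /= ?eqxx ?andbT ?andbF ?orbF => _ xy;
  by move=> /esym/eqP yd /esym/eqP xd; move: xy; rewrite yd xd ?eqxx.
Qed.

(** Passes from the actual labels, listed in [L], to their indices, for which [pat] computes. *)
Lemma pat_nth (L : seq nat) (C : seq letter) i j : uniq L ->
    all (fun l => (l.1 < size L)%N) C -> (i < size L)%N -> (j < size L)%N ->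
  pat (map (relabel (nth 0%N L)) C) (nth 0%N L i) (nth 0%N L j) = pat C i j.
Proof.
move=> uL /allP CL iL jL; rewrite pat_map //.
have mem x : x \in [:: i, j & map fst C] -> (x < size L)%N.
  by rewrite !inE => /predU1P[->|/predU1P[->|/mapP[l /CL lL ->]]].
by move=> x y /mem xL /mem yL /eqP; rewrite nth_uniq // => /eqP.
Qed.

(** Bookkeeping shared by RI and RII. The survivors keep their mutual terms by [pat_filter]; the
    other terms tell how the crossings of [S] see each other, how they see the survivors, and how
    the survivors see them. *)
Lemma wsum_del h S D E : wf D -> wf E -> gsgn E = gsgn D -> uniq S ->
    {subset S <= crossings D} ->
    gword E = [seq l <- gword D | l.1 \notin S] ->
  wsum h D = \sum_(c <- S) h (gsgn D c)
      (\sum_(d <- S | d != c) lkterm D c d + \sum_(d <- crossings E) lkterm D c d)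
    + \sum_(c <- crossings E) h (gsgn E c) (lk E c + \sum_(d <- S) lkterm D c d).
Proof.
move=> wD wE sgnE uS SD defE.
have memE c : (c \in crossings E) = (c \notin S) && (c \in crossings D).
  by rewrite -(mem_crossings _ true) // defE mem_filter /= mem_crossings.
have perm : perm_eq (crossings D) (S ++ crossings E).
  apply: uniq_perm; rewrite ?crossings_uniq //.
    rewrite cat_uniq uS crossings_uniq andbT; apply/hasPn => c /=.
    by rewrite memE => /andP[].
  by move=> c; rewrite mem_cat memE; case: (boolP (c \in S)) => // /SD.
have notS c : c \in crossings E -> forall d, d \in S -> d != c.
  by rewrite memE => /andP[cS _] d dS; apply: contraNneq cS => <-.
rewrite /wsum (perm_big _ perm) big_cat /=; congr (_ + _);
  rewrite big_seq [RHS]big_seq; apply: eq_bigr => c cS; rewrite ?sgnE;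
  congr (h _ _); rewrite lkE (perm_big _ perm) big_cat /=.
  congr (_ + _); rewrite big_seq_cond [RHS]big_seq.
  apply: eq_bigl => d; case: (boolP (d \in _)) => //= /notS dE.
  by rewrite eq_sym dE.
rewrite addrC; congr (_ + _).
  rewrite lkE big_seq_cond [RHS]big_seq_cond; apply: eq_bigr => d /andP[dE _].
  rewrite /lkterm sgnE defE pat_filter //=.
  - by move: cS; rewrite memE => /andP[].
  - by move: cS; rewrite memE => /andP[].
  - by move: dE; rewrite memE => /andP[].
  - by move: dE; rewrite memE => /andP[].
rewrite big_seq_cond [RHS]big_seq; apply: eq_bigl => d.
by case: (boolP (d \in S)) => //= /(notS _ cS).
Qed.

Local Close Scope ring_scope.

(** * Faces of a diagram and of its restriction to a few crossings *)

Lemma face_lenP D d k : k < (gN D).*2 -> face_len D d = k.+1 ->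
  iter k.+1 (phi D) d = d.
Proof.
move=> kN [] fk.
(* The bound on [k] shows that the search succeeded, as a failed one returns the length of the
   list. *)
have h : has (fun k => iter k.+1 (phi D) d == d) (iota 0 (gN D).*2).
  by rewrite has_find fk size_iota.
by have /eqP := nth_find 0 h; rewrite fk nth_iota.
Qed.

(* C is obtained from D by keeping n pairs of consecutive letters, f renaming its
   crossings: letter i of C is letter pos i of D.  The face permutations agree on
   the darts of the n edges inside these pairs, so that a bigon or triangle of D
   bounded by such edges can be examined in C. *)
Section Subcode.
Variables (C D : gcode) (f pos : nat -> nat) (n : nat).
Hypotheses (wC : wf C) (uD : uniq (gword D)) (sizeC : gN C = n.*2) (n_gt0 : 0 < n).
Hypothesis pos0 : pos 0 = 0.
Hypothesis posS : forall i, i < n -> pos i.*2.+1 = (pos i.*2).+1.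
Hypothesis pos_lt : forall i j, i < j -> j < n.*2 -> pos i < pos j.
Hypothesis pos_ltN : forall i, i < n.*2 -> pos i < gN D.
Hypothesis lett_pos : forall i, i < n.*2 -> lett D (pos i) = relabel f (lett C i).
Hypothesis sgn_pos :
  forall i, i < n.*2 -> gsgn D (f (lett C i).1) = gsgn C (lett C i).1.

(** The dart at the image occurrence with the same end, leaving or arriving, which the parity
    records. *)
Definition demb (d : nat) : nat := (pos d./2).*2 + odd d.

Lemma pos_inj i j : i < n.*2 -> j < n.*2 -> pos i = pos j -> i = j.
Proof.
move=> iN jN pij; case: (ltngtP i j) => // [/pos_lt|/pos_lt] /(_ _).
  by move/(_ jN); rewrite pij ltnn.
by move/(_ iN); rewrite pij ltnn.
Qed.

Lemma partner_pos i : i < n.*2 ->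
  partner D (pos i) = pos (partner C i) /\ partner C i < n.*2.
Proof.
move=> iN; have iC : (lett C i) \in gword C by rewrite mem_nth // -/(gN C) sizeC.
have bC : ((lett C i).1, ~~ (lett C i).2) \in gword C.
  by case/andP: wC => _ /allP /(_ _ iC).
have pN : partner C i < n.*2 by rewrite -sizeC /partner /gN index_mem.
split=> //; rewrite {1}/partner lett_pos //=.
have -> : (f (lett C i).1, ~~ (lett C i).2) = lett D (pos (partner C i)).
  by rewrite lett_pos // /lett nth_index.
by rewrite index_uniq // pos_ltN.
Qed.

Lemma dpos_pos i o : i < n.*2 -> dpos D (pos i) o = dpos C i o.
Proof. by move=> iN; rewrite /dpos lett_pos //= sgn_pos. Qed.

(** [sigma] looks only at the two passages of one crossing, so it commutes with the embedding at
    every dart. *)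
Lemma sigma_demb d : d < n.*2.*2 ->
  sigma D (demb d) = demb (sigma C d) /\ sigma C d < n.*2.*2.
Proof.
move=> dN; have iN : d./2 < n.*2 by lia.
have [pE pN] := partner_pos iN.
rewrite /sigma; have -> : (demb d)./2 = pos d./2 by rewrite /demb; lia.
have -> : odd (demb d) = odd d by rewrite /demb; lia.
rewrite pE !dpos_pos //.
have demb2 i (o : bool) : demb (i.*2 + o) = (pos i).*2 + o.
  by case: o; rewrite /demb ?addn0 ?addn1 /= ?doubleK ?uphalf_double ?odd_double ?addn0 ?addn1.
case: ifP => _; first by rewrite demb2; lia.
have := demb2 (partner C d./2) false; have := demb2 (partner C d./2) true.
rewrite /= !addn0 !addn1 => demb1 demb0.
by case: ifP => _; rewrite ?demb0 ?demb1; lia.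
Qed.

Lemma edge_demb d i : d < n.*2.*2 -> i < n ->
  (edge_of D (demb d) == pos i.*2) = (edge_of C d == i.*2).
Proof.
move=> dN iN; rewrite /edge_of.
have -> : (demb d)./2 = pos d./2 by rewrite /demb; lia.
have -> : odd (demb d) = odd d by rewrite /demb; lia.
have jN : d./2 < n.*2 by lia.
have i2N : i.*2 < n.*2 by lia.
case: ifP => _; first by apply/eqP/eqP => [/pos_inj -> //|->].
have := posS iN; have := pos_ltN jN; have i2N1 : i.*2.+1 < n.*2 by lia.
have := pos_ltN i2N1; rewrite sizeC.
(* The edge arriving at occurrence 0 closes the word and lies inside no pair, in [C] and in [D]
   alike. *)
case: (d./2) jN => [|j] jN; rewrite ?pos0.
  move=> h1 h2 h3; rewrite !modn_small; try lia.
have : pos 0 < pos j.+1 by apply: pos_lt.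
rewrite pos0 => h0 h1 h2 h3.
have -> : (pos j.+1 + gN D).-1 = (pos j.+1).-1 + gN D by lia.
have -> : (j.+1 + n.*2).-1 = j + n.*2 by lia.
rewrite !modnDr !modn_small; try lia.
apply/eqP/eqP => [h|->]; last by rewrite h3.
have : pos j.+1 = pos i.*2.+1 by lia.
by move/pos_inj => /(_ jN i2N1) [].
Qed.

(** Unlike [sigma], [alpha] is compatible only along edges inside a pair: the end of one pair and
    the start of the next are neighbours in [C] but need not be in [D]. *)
Lemma phi_demb d i : d < n.*2.*2 -> i < n -> edge_of C d = i.*2 ->
  phi D (demb d) = demb (phi C d) /\ phi C d < n.*2.*2.
Proof.
move=> dN iN dE; rewrite /phi.
suff [-> aN] : alpha D (demb d) = demb (alpha C d) /\ alpha C d < n.*2.*2.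
  exact: sigma_demb.
have i2N : i.*2 < n.*2 by lia.
have i2N1 : i.*2.+1 < n.*2 by lia.
have := pos_ltN i2N1; have := posS iN; move: dE; rewrite /edge_of /alpha sizeC.
have -> : (demb d)./2 = pos d./2 by rewrite /demb; lia.
have -> : odd (demb d) = odd d by rewrite /demb; lia.
case: ifP => _ dE pS pN.
  by rewrite dE -pS !modn_small // /demb doubleK odd_double addn0; lia.
have {}dE : d./2 = i.*2.+1.
  have : d./2 < n.*2 by lia.
  case: (d./2) dE => [|j].
    by move=> h _; move: h; rewrite modn_small; lia.
  have -> : (j.+1 + n.*2).-1 = j + n.*2 by lia.
  by rewrite modnDr => h ?; move: h; rewrite modn_small; lia.
rewrite dE pS.
have -> : ((pos i.*2).+1 + gN D).-1 = pos i.*2 + gN D by lia.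
have -> : (i.*2.+1 + n.*2).-1 = i.*2 + n.*2 by lia.
rewrite !modnDr !modn_small; try lia.
by rewrite /demb /= uphalf_double odd_double; lia.
Qed.

Lemma demb_inj d e : d < n.*2.*2 -> e < n.*2.*2 -> demb d = demb e -> d = e.
Proof.
move=> dN eN; rewrite /demb => h.
have : pos d./2 = pos e./2 by lia.
by move/pos_inj => /(_ ltac:(lia) ltac:(lia)); lia.
Qed.

(** Edge 0 has two darts, 1 leaving occurrence 0 and 2 arriving at occurrence 1, and [demb] fixes
    both. *)
Lemma edge0_demb d : d < (gN D).*2 -> edge_of D d = 0 ->
  exists2 e, e < n.*2.*2 & d = demb e /\ edge_of C e = 0.
Proof.
have p1 := posS n_gt0; have := pos_ltN (_ : 1 < n.*2); rewrite -[1]/(0.*2.+1) p1 pos0 => N1.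
have {}N1 := N1 ltac:(lia); rewrite -[0.*2.+1]/1 in p1.
move=> dN; rewrite /edge_of; case: ifP => od d0.
  by exists 1; [lia|split; rewrite // /demb /= pos0; lia].
exists 2; first lia.
rewrite /edge_of /demb /= p1 pos0 /= sizeC; split; last by rewrite ?add1n modnn.
have : d./2 < gN D by lia.
have : d = d./2.*2 by lia.
case: (d./2) d0 => [|j].
  by rewrite modn_small; lia.
have -> : (j.+1 + gN D).-1 = j + gN D by lia.
by rewrite modnDr => h ?; move: h; rewrite modn_small; lia.
Qed.

Lemma bigon_demb : 1 < n -> bigon_face D 0 (pos 2) ->
  exists2 d, d < n.*2.*2 &
    [/\ edge_of C d = 0, edge_of C (phi C d) = 2 & phi C (phi C d) = d].
Proof.
move=> n_gt1 [d' [dN [fd [e1 e2]]]]; have [d dC [def_d e1C]] := edge0_demb dN e1.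
have NC : gN D > 1 by have := posS n_gt0; have := pos_ltN (ltac:(lia) : 0.*2.+1 < n.*2); lia.
have := face_lenP (ltac:(lia) : 1 < (gN D).*2) fd; rewrite /= => fd2.
subst d'; have [p1 p1C] := phi_demb dC n_gt0 e1C; rewrite p1 in e2 fd2.
have e2C : edge_of C (phi C d) = 2.
  by apply/eqP; rewrite -[2]/(1.*2) -(edge_demb p1C n_gt1) e2.
have [p2 p2C] := phi_demb p1C n_gt1 e2C; rewrite p2 in fd2.
by exists d => //; split=> //; apply: demb_inj fd2.
Qed.

Lemma tri_demb : 2 < n -> tri_face D 0 (pos 2) (pos 4) ->
  exists2 d, d < n.*2.*2 &
    [/\ edge_of C d = 0,
        (edge_of C (phi C d), edge_of C (phi C (phi C d))) \in [:: (2, 4); (4, 2)] &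
        phi C (phi C (phi C d)) = d].
Proof.
move=> n_gt2 [d' [dN [fd [e1 e23]]]]; have [d dC [def_d e1C]] := edge0_demb dN e1.
have n_gt1 := ltnW n_gt2.
have NC : gN D > 1 by have := posS n_gt0; have := pos_ltN (ltac:(lia) : 0.*2.+1 < n.*2); lia.
have := face_lenP (ltac:(lia) : 2 < (gN D).*2) fd; rewrite /= => fd3.
subst d'; have [p1 p1C] := phi_demb dC n_gt0 e1C; rewrite p1 in e23 fd3.
(* [tri_face] allows both cyclic orders of the edges; [i] and [j] name the pairs met second and
   third. *)
suff [i [j [iN jN ij [e2 e3]]]] : exists i j, [/\ i < n, j < n,
    (i.*2, j.*2) \in [:: (2, 4); (4, 2)] &
    edge_of D (demb (phi C d)) = pos i.*2 /\
    edge_of D (phi D (demb (phi C d))) = pos j.*2].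
  have e2C : edge_of C (phi C d) = i.*2.
    by apply/eqP; rewrite -(edge_demb p1C iN) e2.
  have [p2 p2C] := phi_demb p1C iN e2C; rewrite p2 in e3 fd3.
  have e3C : edge_of C (phi C (phi C d)) = j.*2.
    by apply/eqP; rewrite -(edge_demb p2C jN) e3.
  have [p3 p3C] := phi_demb p2C jN e3C; rewrite p3 in fd3.
  by exists d => //; split; rewrite ?e2C ?e3C //; apply: demb_inj fd3.
by case: e23 => -[]; [exists 1, 2 | exists 2, 1].
Qed.
End Subcode.

Local Open Scope ring_scope.

(** * Reidemeister moves *)

(** [F] is a change of $I_{lk}$, seen through its pairing with every weight [h]. The parameters are
    chosen before [h], so they are the same for all weights. *)
Definition change (k : mkind) (F : (bool -> int -> int) -> int) : Prop :=
  match k with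
  | RI => exists t e, forall h, F h = sgnz t * h e 0
  | RIIm => exists t m, forall h, F h = sgnz t * (h true m + h false (m + 1))
  | RIIu => exists t m, forall h, F h = sgnz t * (h true m + h false m)
  | RIII => exists t e m, forall h, F h = sgnz t * (h e (m + 1) - h e m)
  end.

Lemma sgnzN b : sgnz (~~ b) = - sgnz b.
Proof. by case: b; rewrite /sgnz ?opprK. Qed.

Lemma changeN k F G : change k F -> (forall h, G h = - F h) -> change k G.
Proof.
by case: k => /= -[t [e]]; [| | | case=> m] => FE GE; exists (~~ t), e; [..|exists m];
  move=> h; rewrite GE FE sgnzN mulNr.
Qed.

Lemma filter_fst_cons (S : seq nat) (s : seq letter) d :
    {in s, forall l, l.1 \notin S} ->
  [seq l <- s | l.1 \in d :: S] = [seq l <- s | l.1 == d].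
Proof.
by move=> sS; apply: eq_in_filter => l /sS /negbTE lS; rewrite inE lS orbF.
Qed.

Lemma filter_fst_notin (S : seq nat) (s : seq letter) :
  {in s, forall l, l.1 \notin S} -> [seq l <- s | l.1 \notin S] = s.
Proof. by move=> sS; apply/all_filterP/allP. Qed.

Lemma filter_fst_in (S : seq nat) (s : seq letter) :
  {in s, forall l, l.1 \notin S} -> [seq l <- s | l.1 \in S] = [::].
Proof.
by move=> sS; rewrite -(filter_pred0 s); apply: eq_in_filter => l /sS /negbTE.
Qed.

(** * Moves of type RI *)

Definition kink_word (b b' : bool) : seq letter :=
  [:: (0, b); (0, ~~ b); (1, b'); (1, ~~ b')]%N.

(** The two passages of a kink are adjacent, so another crossing has both its passages on one
    component of the smoothing there, and the kink lies within one component of any other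
    smoothing. *)
Lemma kink_pat b b' :
  pat (kink_word b b') 0 1 = false /\ pat (kink_word b b') 1 0 = false.
Proof. by case: b; case: b'. Qed.

Lemma del_RI D E : wf D -> wf E -> del RI D E ->
  change RI (fun h => wsum h E - wsum h D).
Proof.
move=> wD wE [sgnE [c [b [s [defD defE]]]]].
have sc : {in s, forall l, l.1 \notin [:: c]}.
  have := wf_uniq wD; rewrite defD /= !inE => /and3P[+ c2 _] -[d b'] ls /=.
  rewrite negb_or inE => /andP[_ c1]; apply: contraTneq ls => ->.
  by case: b b' c1 c2 {defD} => [] [].
have cD : c \in crossings D by rewrite -(mem_crossings c b) // defD mem_head.
have cE d : d \in crossings E -> c != d.
  rewrite -(mem_crossings d true) // defE => /sc /=.
  by rewrite inE eq_sym.
have pE d : d \in crossings E -> (pat (gword D) c d = false) * (pat (gword D) d c = false).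
  move=> dE; have [b' fd] := pair_filter wE dE.
  have fD : [seq l <- gword D | l.1 \in [:: d; c]] =
      map (relabel (nth 0%N [:: c; d])) (kink_word b b').
    by rewrite defD /= !inE eqxx orbT filter_fst_cons // -defE fd.
  have uL : uniq [:: c; d] by rewrite /= inE cE.
  have pF i j : i \in [:: d; c] -> j \in [:: d; c] -> pat (gword D) i j =
      pat (map (relabel (nth 0%N [:: c; d])) (kink_word b b')) i j.
    by move=> iL jL; rewrite -fD pat_filter.
  have [p1 p2] := kink_pat b b'.
  have q1 := pat_nth (C := kink_word b b') (i := 0%N) (j := 1%N) uL erefl erefl erefl.
  have q2 := pat_nth (C := kink_word b b') (i := 1%N) (j := 0%N) uL erefl erefl erefl.
  by split; rewrite pF ?inE ?eqxx ?orbT //; [apply: etrans q1 p1 | apply: etrans q2 p2].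
exists false, (gsgn D c) => h.
rewrite (@wsum_del h [:: c] D E) //; first last.
- by rewrite defD defE /= inE eqxx /= filter_fst_notin.
- by move=> d; rewrite inE => /eqP->.
rewrite !big_seq1 big_cons big_nil eqxx /= big1_seq ?addr0; last first.
  by move=> d /pE[p _]; rewrite /lkterm p.
rewrite (eq_big_seq (fun d => h (gsgn E d) (lk E d))) => [|d /pE[_ p]].
  by rewrite -/(wsum h E) mulN1r opprD addrCA subrr addr0.
by rewrite big_seq1 /lkterm p addr0.
Qed.

(** * Moves of type RII *)

Definition bigon_word (m : bool) (u1 u2 : seq letter) : seq letter :=
  [:: (0, true); (1, true)]%N ++ u1 ++
  (if m then [:: (0, false); (1, false)] else [:: (1, false); (0, false)])%N ++ u2.

(** [u1] and [u2] hold the passages of a third crossing 2. Crossings 0 and 1 are consecutive on both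
    strands of the bigon, so no passage of another crossing comes between them. *)
Lemma bigon_pat m b u1 u2 : u1 ++ u2 = [:: (2, b); (2, ~~ b)]%N ->
  let w := bigon_word m u1 u2 in
  pat w 2 0 = pat w 2 1 /\ pat w 0 2 = pat w 1 2.
Proof.
by case: u1 => [/= ->|x [/= [-> ->]|y [/= [-> ->] ->|]]] //; case: m; case: b.
Qed.

(** The word is compatible with any signs; the face of length two forces opposite ones. Enumeration
    of both orientations, all signs and the eight darts. *)
Lemma bigon_sign m sa sb d : (d < 8)%N ->
  let C := GCode (bigon_word m [::] [::]) (nth false [:: sa; sb]) in
  [/\ edge_of C d = 0%N, edge_of C (phi C d) = 2 & phi C (phi C d) = d]%N ->
  sb = ~~ sa.
Proof.
move=> dN C [] /eqP e1 /eqP e2 /eqP e3.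
suff /allP /(_ d) : all (fun d => [&& edge_of C d == 0, edge_of C (phi C d) == 2
    & phi C (phi C d) == d] ==> (sb == ~~ sa))%N (iota 0 8).
  by rewrite mem_iota e1 e2 e3 /= => /(_ dN) /eqP.
by rewrite {e1 e2 e3}/C {C}; case: m; case: sa; case: sb; vm_compute.
Qed.

Lemma wf_bigon m s : wf (GCode (bigon_word m [::] [::]) s).
Proof. by case: m. Qed.

Lemma relabel_bigon m a b u1 u2 :
  map (relabel (nth 0%N [:: a; b])) (bigon_word m u1 u2) =
  [:: (a, true); (b, true)] ++ map (relabel (nth 0%N [:: a; b])) u1 ++
  (if m then [:: (a, false); (b, false)] else [:: (b, false); (a, false)]) ++
  map (relabel (nth 0%N [:: a; b])) u2.
Proof. by rewrite /bigon_word !map_cat; case: m. Qed.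

Section DelRII.
Variables (D E : gcode) (m : bool) (a b : nat) (s1 s2 : seq letter).
Hypotheses (wD : wf D) (wE : wf E) (sgnE : gsgn E = gsgn D) (neq_ab : a != b).
Hypothesis defD : gword D = [:: (a, true); (b, true)] ++ s1 ++
  (if m then [:: (a, false); (b, false)] else [:: (b, false); (a, false)]) ++ s2.
Hypothesis defE : gword E = s1 ++ s2.
Hypothesis face : bigon_face D 0 (size s1).+2.

Lemma rii_sign : gsgn D b = ~~ gsgn D a.
Proof.
set C := GCode (bigon_word m [::] [::]) (nth false [:: gsgn D a; gsgn D b]).
(* Positions in the word of [D] of the four corner passages of the bigon. *)
pose pos := nth 0%N [:: 0; 1; (size s1).+2; (size s1).+3]%N.
have szD : gN D = (size s1 + size s2).+4.
  by rewrite /gN defD !size_cat; case: (m) => /=; lia.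
have [|||||||||d dC] := @bigon_demb C D (nth 0%N [:: a; b]) pos 2
    (wf_bigon _ _) (wf_uniq wD) _ _ _ _ _ _ _ _ _ face => //.
- by rewrite /C /gN; case: (m).
- by case=> [|[|]].
- by rewrite /pos; case=> [|[|[|[|?]]]] [|[|[|[|?]]]] /= *; lia.
- by rewrite szD; case=> [|[|[|[|]]]] // _; rewrite /pos /=; lia.
- rewrite /lett defD; case=> [|[|[|[|]]]] // _;
  by rewrite /C /bigon_word /= nth_cat ?ltnn ?subnn ?ltnNge ?leqnSn //= ?subSnn; case: (m).
- by rewrite /C /bigon_word /lett; case: (m); case=> [|[|[|[|]]]].
exact: bigon_sign.
Qed.

Lemma rii_notin : {in s1 ++ s2, forall l, l.1 \notin [:: a; b]}.
Proof.
move=> [c e] ls; have : perm_eq (gword D) ([:: (a, true); (b, true)] ++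
    (if m then [:: (a, false); (b, false)] else [:: (b, false); (a, false)]) ++ s1 ++ s2).
  by rewrite defD perm_cat2l perm_catCA.
move/perm_uniq; rewrite wf_uniq // catA cat_uniq => /esym/and3P[_ /hasPn /(_ _ ls) + _]; clear ls.
by rewrite !inE /=; apply: contra => /pred2P[]->; case: (m); case: e;
   rewrite /= !inE !eqxx ?orbT.
Qed.

Lemma rii_notin1 : {in s1, forall l, l.1 \notin [:: a; b]}.
Proof. by move=> l ls; apply: rii_notin; rewrite mem_cat ls. Qed.

Lemma rii_notin2 : {in s2, forall l, l.1 \notin [:: a; b]}.
Proof. by move=> l ls; apply: rii_notin; rewrite mem_cat ls orbT. Qed.

Lemma rii_pat d : d \in crossings E ->
  pat (gword D) d a = pat (gword D) d b /\ pat (gword D) a d = pat (gword D) b d.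
Proof.
move=> dE; have [e fd] := pair_filter wE dE.
have dS : d \notin [:: a; b].
  by have /rii_notin : (d, true) \in s1 ++ s2 by rewrite -defE mem_crossings.
have uL : uniq [:: a; b; d].
  by move: dS; rewrite /= !inE !negb_or neq_ab ![_ == d]eq_sym andbT => /andP[-> ->].
pose f := nth 0%N [:: a; b; d].
have [u1 [u2 [def_u fu1 fu2]]] : exists u1 u2,
    [/\ u1 ++ u2 = [:: (2, e); (2, ~~ e)]%N,
     [seq l <- s1 | l.1 == d] = map (relabel f) u1 &
     [seq l <- s2 | l.1 == d] = map (relabel f) u2].
  move: fd; rewrite defE filter_cat.
  case: [seq l <- s1 | l.1 == d] => [/= ->|x [/= [-> ->]|y [/= [-> ->] ->|]]] //.
  - by exists [::], [:: (2, e); (2, ~~ e)]%N.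
  - by exists [:: (2, e)]%N, [:: (2, ~~ e)]%N.
  - by exists [:: (2, e); (2, ~~ e)]%N, [::].
have fD : [seq l <- gword D | l.1 \in [:: d; a; b]] = map (relabel f) (bigon_word m u1 u2).
  rewrite defD !filter_cat (filter_fst_cons d rii_notin1) (filter_fst_cons d rii_notin2).
  rewrite fu1 fu2 /bigon_word !map_cat.
  by case: (m); rewrite /= !inE !eqxx !orbT.
have pF i j : i \in [:: d; a; b] -> j \in [:: d; a; b] -> pat (gword D) i j =
    pat (map (relabel f) (bigon_word m u1 u2)) i j.
  by move=> iL jL; rewrite -fD pat_filter.
have lt3 : all (fun l => l.1 < size [:: a; b; d])%N (bigon_word m u1 u2).
  have : all (fun l => l.1 < 3)%N (u1 ++ u2) by rewrite def_u.
  by rewrite /bigon_word !all_cat => /andP[-> ->]; case: (m).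
have fL i : (i < 3)%N -> f i \in [:: d; a; b].
  by case: i => [|[|[|]]] // _; rewrite /f /= !inE eqxx ?orbT.
have pN i j : (i < 3)%N -> (j < 3)%N -> pat (gword D) (f i) (f j) = pat (bigon_word m u1 u2) i j.
  by move=> i3 j3; rewrite pF ?fL // pat_nth.
have [p1 p2] := bigon_pat m def_u.
have := pN 2%N 0%N; have := pN 2%N 1%N; have := pN 0%N 2%N; have := pN 1%N 2%N.
by rewrite /f /= => -> // -> // -> // -> //; split.
Qed.

(** The passages of [a] and [b] interleave in the matched case and are nested in the unmatched one,
    where neither crossing meets both components of the smoothing at the other. *)
Lemma rii_pat_ab : pat (gword D) a b = false /\ pat (gword D) b a = m.
Proof.
have uL : uniq [:: a; b] by rewrite /= inE neq_ab.
have fD : [seq l <- gword D | l.1 \in [:: a; b]] =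
    map (relabel (nth 0%N [:: a; b])) (bigon_word m [::] [::]).
  rewrite defD !filter_cat (filter_fst_in rii_notin1) (filter_fst_in rii_notin2) relabel_bigon.
  by case: (m); rewrite /= !inE !eqxx !orbT.
have pF i j : i \in [:: a; b] -> j \in [:: a; b] -> pat (gword D) i j =
    pat (map (relabel (nth 0%N [:: a; b])) (bigon_word m [::] [::])) i j.
  by move=> iL jL; rewrite -fD pat_filter.
have lt2 : all (fun l => l.1 < size [:: a; b])%N (bigon_word m [::] [::]) by case: (m).
have q1 := pat_nth (i := 0%N) (j := 1%N) uL lt2 erefl erefl.
have q2 := pat_nth (i := 1%N) (j := 0%N) uL lt2 erefl erefl.
split; rewrite pF ?inE ?eqxx ?orbT //; [apply: etrans q1 _ | apply: etrans q2 _];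
  by case: (m).
Qed.

Lemma change_rii : change (if m then RIIm else RIIu) (fun h => wsum h E - wsum h D).
Proof.
set K := \sum_(d <- crossings E) lkterm D a d.
have KE : \sum_(d <- crossings E) lkterm D b d = K.
  by apply: eq_big_seq => d /rii_pat[_ p]; rewrite /lkterm p.
have [pab pba] := rii_pat_ab.
have W h : wsum h E - wsum h D =
    - (h (gsgn D a) K + h (~~ gsgn D a) (K + (if m then sgnz (gsgn D a) else 0))).
  rewrite (@wsum_del h [:: a; b] D E) //; first last.
  - rewrite defD defE !filter_cat (filter_fst_notin rii_notin1) (filter_fst_notin rii_notin2).
    by case: (m); rewrite /= !inE !eqxx !orbT.
  - move=> d; rewrite !inE => /pred2P[]->; rewrite -(mem_crossings _ true) // defD;
    by rewrite !inE eqxx ?orbT.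
  - by rewrite /= inE neq_ab.
  rewrite !big_cons !big_nil !eqxx neq_ab eq_sym neq_ab /= !addr0 KE -/K.
  (* A survivor sees both or neither of [a] and [b], whose opposite signs cancel. *)
  rewrite (eq_big_seq (fun d => h (gsgn E d) (lk E d))) => [|d /rii_pat[p _]]; last first.
    rewrite !big_cons big_nil /lkterm p rii_sign addr0.
    by case: ifP; rewrite ?sgnzN ?addrN ?addr0.
  rewrite -/(wsum h E) {1 2}/lkterm pab pba add0r rii_sign (addrC K).
  by ring.
case: (m) W => W.
  case: (gsgn D a) W => W.
    by exists false, K => h; rewrite W mulN1r.
  (* For negative [a] the crossing [b] is positive with linking number [K - 1], which is the index
     of the $X$ term. *)
  by exists false, (K - 1) => h; rewrite W mulN1r subrK addrC.
by exists false, K => h; rewrite W mulN1r addr0; case: (gsgn D a) => //; rewrite addrC.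
Qed.
End DelRII.

(** * Moves of type RIII *)

(* The possible words of the three strands of an RIII move, with top crossings
   0, 1 and third crossing 2, up to renaming. *)
Definition tri_words : seq (seq letter) :=
  [seq [:: (0, true); (1, true)]%N ++ p |
    p <- permutations [:: (0, false); (1, false); (2, true); (2, false)]%N].

Definition swap_pairs (w : seq letter) : seq letter :=
  if w is [:: l1; l2; l3; l4; l5; l6] then [:: l2; l1; l4; l3; l6; l5] else w.

Definition pairs_distinct (w : seq letter) : bool :=
  if w is [:: l1; l2; l3; l4; l5; l6]
  then [&& l1.1 != l2.1, l3.1 != l4.1 & l5.1 != l6.1] else false.

(** The part of the change of the linking number at corner [i] that is due to the other two corners.
    It is a [foldr] because the locked big operators do not compute. *)
Definition tri_delta (w : seq letter) (s : nat -> bool) (i : nat) : int :=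
  foldr +%R 0 [seq (if pat (swap_pairs w) i j then sgnz (s j) else 0) -
                   (if pat w i j then sgnz (s j) else 0) | j <- iota 0 3 & j != i].

Definition tri_single (w : seq letter) (s : nat -> bool) : bool :=
  has (fun i0 => (tri_delta w s i0 \in [:: 1; -1]) &&
         all (fun i => (i == i0) || (tri_delta w s i == 0)) (iota 0 3)) (iota 0 3).

(** Enumeration of 24 words, 8 sign patterns and 12 darts. The face condition discards impossible
    pictures, such as words with both passages of crossing 2 in one pair. *)
Lemma tri_check (w : seq letter) (s0 s1 s2 : bool) d : w \in tri_words ->
  let s := nth false [:: s0; s1; s2] in let C := GCode w s in (d < 12)%N ->
  [/\ edge_of C d = 0%N,
      (edge_of C (phi C d), edge_of C (phi C (phi C d))) \in [:: (2, 4); (4, 2)]%N &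
      phi C (phi C (phi C d)) = d] ->
  pairs_distinct w && tri_single w s.
Proof.
move=> wT s C dN [] /eqP e1 e2 /eqP e3.
suff /allP /(_ w wT) /allP /(_ d) : all (fun w => all (fun d => let C := GCode w s in
    [&& edge_of C d == 0%N,
      (edge_of C (phi C d), edge_of C (phi C (phi C d))) \in [:: (2, 4); (4, 2)]%N &
      phi C (phi C (phi C d)) == d] ==> (pairs_distinct w && tri_single w s))
    (iota 0 12)) tri_words.
  by rewrite mem_iota => /(_ dN); rewrite /= -/C e1 e2 e3.
rewrite {C e1 e2 e3} /s.
by case: s0; case: s1; case: s2; vm_compute.
Qed.

Lemma tri_words_wf w s : w \in tri_words ->
  [/\ wf (GCode w s), size w = 6%N & all (fun l => l.1 < 3)%N w].
Proof.
move=> wT; suff /allP /(_ w wT) /and3P[? /eqP ? ?] : all (fun w => [&& wf (GCode w s),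
    size w == 6%N & all (fun l => l.1 < 3)%N w]) tri_words by split.
by vm_compute.
Qed.

(** Six distinct letters over three crossings are all their passages, so the two initial
    over-passages leave free only the order of the other four. *)
Lemma tri_label (s : seq letter) l1 l2 t : s = [:: l1, l2 & t] -> size s = 6%N ->
    uniq s -> l1.2 && l2.2 -> size (undup (map fst s)) = 3%N ->
  exists L w, [/\ uniq L, size L = 3%N, w \in tri_words,
    s = map (relabel (nth 0%N L)) w & forall l, (l \in s) = (l.1 \in L)].
Proof.
case: l1 l2 => [x []] [y []] def_s s6 us //= _.
set M := undup _ => M3; have uM : uniq M := undup_uniq _.
have sM l : (l \in s) = (l.1 \in M).
  have sub : {subset s <= [seq (c, b) | c <- M, b <- [:: true; false]]}.
    move=> [c b] cs; apply/allpairsP; exists (c, b); split=> //=.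
      by rewrite mem_undup (map_f fst cs).
    by case: b {cs}.
  have [|_ ->] := uniq_min_size us sub; first by rewrite size_allpairs M3 s6.
  case: l => c b; apply/allpairsP/idP => [[[c' b'] [/= ? _ [-> _]]] //|cM].
  by exists (c, b); split=> //=; case: (b).
have xs : (x, true) \in s by rewrite def_s mem_head.
have ys : (y, true) \in s by rewrite def_s !inE eqxx orbT.
have xy : x != y.
  by move: us; rewrite def_s /= inE xpair_eqE andbT negb_or => /andP[/andP[]].
have [z Lz] : exists z, perm_eq M [:: x; y; z].
  have xM : x \in M by rewrite -(sM (x, true)).
  have yM : y \in rem x M by rewrite mem_rem_uniq // inE eq_sym xy -(sM (y, true)).
  have := perm_to_rem xM; have := perm_to_rem yM.
  have := size_rem yM; rewrite (size_rem xM) M3.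
  case: (rem y _) => [|z [|]] // _ p1 p2; exists z.
  by apply: perm_trans p2 _; rewrite perm_cons.
have uL : uniq [:: x; y; z] by rewrite -(perm_uniq Lz).
have sL l : (l \in s) = (l.1 \in [:: x; y; z]) by rewrite sM (perm_mem Lz).
have [xz yz] : x != z /\ y != z.
  by move: uL; rewrite /= !inE negb_or andbT => /andP[/andP[_ ->] ->].
have pt : perm_eq t [:: (x, false); (y, false); (z, true); (z, false)].
  apply: uniq_perm; first by move: us; rewrite def_s => /and3P[].
    by rewrite /= !inE !xpair_eqE (negbTE xy) (negbTE xz) (negbTE yz) !andbF.
  have nt l : (l \in t) = [&& l \in s, l != (x, true) & l != (y, true)].
    rewrite def_s !inE; case: eqVneq => [->|_] /=.
      by move: us; rewrite def_s /= inE negb_or => /andP[/andP[_ /negbTE]].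
    case: eqVneq => [->|_] /=; last by rewrite andbT.
    by move: us; rewrite def_s => /and3P[_ /negbTE].
  move=> [c b]; rewrite nt sL !inE /= !xpair_eqE.
  case: b; rewrite /= ?andbT ?andbF ?orbF /=; last first.
    by case: (c == x); case: (c == y); case: (c == z).
  case: (eqVneq c x) => [->|_] /=; first by rewrite (negbTE xz).
  by case: (eqVneq c y) => [->|_] /=; rewrite ?(negbTE yz) ?andbT.
pose g (l : letter) := (index l.1 [:: x; y; z], l.2).
exists [:: x; y; z], ([:: (0, true); (1, true)]%N ++ map g t); split=> //.
  apply: map_f; rewrite mem_permutations.
  have -> : [:: (0, false); (1, false); (2, true); (2, false)]%N =
      map g [:: (x, false); (y, false); (z, true); (z, false)].
    by rewrite /g /= !eqxx (negbTE xy) (negbTE xz) (negbTE yz).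
  exact: perm_map.
rewrite def_s map_cat /=; congr [:: _, _ & _].
rewrite -map_comp map_id_in // => -[c b] ct /=; rewrite /relabel /= nth_index //.
by rewrite -(sL (c, b)) def_s !inE ct !orbT.
Qed.

Lemma map_swap_pairs f w : map (relabel f) (swap_pairs w) = swap_pairs (map (relabel f) w).
Proof. by case: w => [|? [|? [|? [|? [|? [|? []]]]]]]. Qed.

Lemma all_swap_pairs P w : all P (swap_pairs w) = all P w.
Proof.
case: w => [|a [|b [|c [|d [|e [|g []]]]]]] //=.
by case: (P a); case: (P b); case: (P c); case: (P d); case: (P e); case: (P g).
Qed.

Lemma pairs_distinct_nth L w : uniq L -> all (fun l => l.1 < size L)%N w ->
  pairs_distinct w -> pairs_distinct (map (relabel (nth 0%N L)) w).
Proof.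
move=> uL; case: w => [|a [|b [|c [|d [|e [|g []]]]]]] //=.
by do 6 case/andP => ?; move=> _; rewrite !nth_uniq.
Qed.

(** The swapped letters belong to distinct crossings of [L], and at most one of [a] and [d] is in
    [L], so the filter keeps at most one letter, whose order cannot matter. *)
Lemma filter_swap (L : seq nat) a d (l l' : letter) : l.1 \in L -> l'.1 \in L ->
    l.1 != l'.1 -> ~~ ((a \in L) && (d \in L)) ->
  [seq k <- [:: l; l'] | k.1 \in [:: a; d]] = [seq k <- [:: l'; l] | k.1 \in [:: a; d]].
Proof.
move=> lL lL' ll' adL /=; case: ifP => [|//]; case: ifP => // l1 l2; move: l1 l2 ll' adL.
by rewrite !inE => /pred2P[] <- /pred2P[] <-; rewrite ?lL ?lL' // eqxx.
Qed.

Lemma nth_cat_add (T : Type) (x0 : T) s t i : nth x0 (s ++ t) (size s + i) = nth x0 t i.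
Proof. by rewrite nth_cat ltnNge leq_addr addKn. Qed.

Lemma perm_six_out (T : eqType) (l1 l2 l3 l4 l5 l6 : T) s1 s2 s3 :
  perm_eq ([:: l1; l2] ++ s1 ++ [:: l3; l4] ++ s2 ++ [:: l5; l6] ++ s3)
          ([:: l1; l2; l3; l4; l5; l6] ++ s1 ++ s2 ++ s3).
Proof. by apply/permP => P; rewrite !count_cat /=; lia. Qed.

Section DelRIII.
Variables (D E : gcode) (l1 l2 l3 l4 l5 l6 : letter) (s1 s2 s3 : seq letter).
Hypotheses (wD : wf D) (wE : wf E) (sgnE : gsgn E = gsgn D).
Hypothesis defD :
  gword D = [:: l1; l2] ++ s1 ++ [:: l3; l4] ++ s2 ++ [:: l5; l6] ++ s3.
Hypothesis defE :
  gword E = [:: l2; l1] ++ s1 ++ [:: l4; l3] ++ s2 ++ [:: l6; l5] ++ s3.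
Hypothesis face : tri_face D 0 (size s1).+2 (size s1 + size s2).+4.
Let s := [:: l1; l2; l3; l4; l5; l6].
Variables (L : seq nat) (w : seq letter).
Hypotheses (uL : uniq L) (L3 : size L = 3%N) (wT : w \in tri_words).
Hypothesis def_s : s = map (relabel (nth 0%N L)) w.
Hypothesis mem_s : forall l, (l \in s) = (l.1 \in L).
Let f := nth 0%N L.
Let sg := nth false (map (gsgn D) L).

Lemma riii_check : pairs_distinct w && tri_single w sg.
Proof.
have [wC w6 w3] := tri_words_wf sg wT; pose C := GCode w sg.
pose pos := nth 0%N [:: 0; 1; (size s1).+2; (size s1).+3; (size s1 + size s2).+4;
                      (size s1 + size s2).+4.+1]%N.
have szD : gN D = (size s1 + size s2 + size s3).+2.+4.
  by rewrite /gN defD !size_cat /=; lia.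
have [||||||||d dC]:= @tri_demb C D f pos 3 wC (wf_uniq wD) w6 _ _ _ _ _ _ _ _ face => //.
- by case=> [|[|[|]]].
- by rewrite /pos; case=> [|[|[|[|[|[|?]]]]]] [|[|[|[|[|[|?]]]]]] //= *; lia.
- by rewrite szD /pos; case=> [|[|[|[|[|[|?]]]]]] //= *; lia.
- move=> i i6; have -> : relabel f (lett C i) = nth (0, false)%N s i.
    by rewrite def_s (nth_map (0, false)%N) ?w6.
  rewrite /lett defD; case: i i6 => [|[|[|[|[|[|]]]]]] //= _.
  + by rewrite -[size s1]addn0 nth_cat_add.
  + by rewrite -[(size s1).+1]addn1 nth_cat_add.
  + by rewrite -!addnS nth_cat_add /= -[size s2]addn0 nth_cat_add.
  + by rewrite -!addnS nth_cat_add /= -[(size s2).+1]addn1 nth_cat_add.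
- move=> i i6; rewrite /C /sg /= (nth_map 0%N) // L3.
  by apply: (allP w3); rewrite mem_nth ?w6.
have : exists t0 t1 t2, map (gsgn D) L = [:: t0; t1; t2].
  by case: (L) L3 => [|x [|y [|z []]]] // _; exists (gsgn D x), (gsgn D y), (gsgn D z).
rewrite /C /sg => -[t0 [t1 [t2 ->]]]; exact: tri_check.
Qed.

Lemma riii_perm : perm_eq (gword D) (s ++ s1 ++ s2 ++ s3).
Proof. by rewrite defD; exact: perm_six_out. Qed.

Lemma riii_rest l : l \in s1 ++ s2 ++ s3 -> l.1 \notin L.
Proof.
have := wf_uniq wD; rewrite (perm_uniq riii_perm) cat_uniq => /and3P[_ /hasPn h _].
by move/h; rewrite /= mem_s.
Qed.

Lemma riii_rest1 : {in s1, forall l, l.1 \notin L}.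
Proof. by move=> l ls; apply: riii_rest; rewrite mem_cat ls. Qed.

Lemma riii_rest2 : {in s2, forall l, l.1 \notin L}.
Proof. by move=> l ls; apply: riii_rest; rewrite !mem_cat ls orbT. Qed.

Lemma riii_rest3 : {in s3, forall l, l.1 \notin L}.
Proof. by move=> l ls; apply: riii_rest; rewrite !mem_cat ls !orbT. Qed.

Lemma riii_crossings : perm_eq (crossings E) (crossings D).
Proof.
apply: uniq_perm; rewrite ?crossings_uniq // => c.
rewrite -!(mem_crossings c true) // (perm_mem riii_perm) defE !mem_cat !inE.
by do ![case: (_ == _) => //=]; rewrite ?orbT ?orbF.
Qed.

Lemma riii_mem i : (i < 3)%N -> f i \in L.
Proof. by move=> i3; rewrite mem_nth ?L3. Qed.

Lemma riii_pat i j : (i < 3)%N -> (j < 3)%N ->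
  pat (gword D) (f i) (f j) = pat w i j /\ pat (gword E) (f i) (f j) = pat (swap_pairs w) i j.
Proof.
move=> i3 j3; have [_ _ w3] := tri_words_wf sg wT.
have sL : all (fun l => l.1 \in L) s by apply/allP => l; rewrite mem_s.
have fD : [seq l <- gword D | l.1 \in L] = map (relabel f) w.
  rewrite defD !filter_cat (filter_fst_in riii_rest1) (filter_fst_in riii_rest2).
  rewrite (filter_fst_in riii_rest3) -def_s /=.
  by move: sL => /and5P[-> -> -> -> /and3P[-> -> _]].
have fE : [seq l <- gword E | l.1 \in L] = map (relabel f) (swap_pairs w).
  rewrite map_swap_pairs -def_s.
  rewrite defE !filter_cat (filter_fst_in riii_rest1) (filter_fst_in riii_rest2).
  rewrite (filter_fst_in riii_rest3) /=.
  by move: sL => /and5P[-> -> -> -> /and3P[-> -> _]].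
split.
  by rewrite -(pat_filter (P := fun l => l.1 \in L)) ?riii_mem // fD pat_nth ?L3.
by rewrite -(pat_filter (P := fun l => l.1 \in L)) ?riii_mem // fE pat_nth ?all_swap_pairs ?L3.
Qed.

Lemma riii_pat_out a d : ~~ ((a \in L) && (d \in L)) ->
  pat (gword E) a d = pat (gword D) a d.
Proof.
move=> adL; have /andP[pd _] := riii_check; have [_ _ w3] := tri_words_wf sg wT.
have := @pairs_distinct_nth L w uL; rewrite L3 -def_s => /(_ w3 pd) /and3P[d1 d2 d3].
have sL l : l \in s -> l.1 \in L by rewrite mem_s.
have fL l l' : l \in s -> l' \in s -> l.1 != l'.1 ->
    [seq k <- [:: l; l'] | k.1 \in [:: a; d]] = [seq k <- [:: l'; l] | k.1 \in [:: a; d]].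
  by move=> ls ls' ll'; apply: (filter_swap (L := L)); rewrite ?sL.
rewrite -(pat_filter (P := fun l => l.1 \in [:: a; d])) ?inE ?eqxx ?orbT //.
rewrite -[RHS](pat_filter (P := fun l => l.1 \in [:: a; d])) ?inE ?eqxx ?orbT //.
congr (pat _ a d); rewrite defD defE !filter_cat.
by rewrite (fL l1 l2) ?(fL l3 l4) ?(fL l5 l6) // !inE eqxx ?orbT.
Qed.

Let delta c : int := \sum_(d <- crossings D | d != c) (lkterm E c d - lkterm D c d).

Lemma riii_lk c : lk E c = lk D c + delta c.
Proof. by rewrite /delta sumrB !lkE (perm_big _ riii_crossings) /= addrC subrK. Qed.

Lemma lkterm_out a d : ~~ ((a \in L) && (d \in L)) -> lkterm E a d - lkterm D a d = 0.
Proof. by move=> adL; rewrite /lkterm riii_pat_out // sgnE subrr. Qed.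

Lemma delta_out c : c \notin L -> delta c = 0.
Proof. by move=> cL; apply: big1 => d _; rewrite lkterm_out ?negb_and ?cL. Qed.

Lemma riii_split : exists2 R, perm_eq (crossings D) (map f (iota 0 3) ++ R) &
  {in R, forall c, c \notin L}.
Proof.
have -> : map f (iota 0 3) = L by rewrite -L3; exact: mkseq_nth.
exists [seq c <- crossings D | c \notin L] => [|c]; last by rewrite mem_filter => /andP[].
apply: uniq_perm; rewrite ?crossings_uniq // ?cat_uniq ?uL ?filter_uniq ?crossings_uniq //.
  by rewrite andbT; apply/hasPn => c; rewrite mem_filter => /andP[].
move=> c; rewrite mem_cat mem_filter; case: (boolP (c \in L)) => //= cL.
by rewrite -(mem_crossings c true) // (perm_mem riii_perm) mem_cat mem_s /= cL.
Qed.

Lemma delta_in i : (i < 3)%N -> delta (f i) = tri_delta w sg i.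
Proof.
move=> i3; have [R DR RL] := riii_split.
rewrite /delta (perm_big _ DR) big_cat /= [X in _ + X]big_seq_cond.
rewrite [X in _ + X]big1 => [|d /andP[/RL dR _]]; last first.
  by rewrite lkterm_out // negb_and dR orbT.
rewrite addr0 -[f 0%N :: _]/(map f (iota 0 3)) big_map /tri_delta foldrE big_map big_filter.
rewrite big_seq_cond [RHS]big_seq_cond; apply: eq_big => j.
  by rewrite mem_iota /=; case: (ltnP j 3) => //= j3; rewrite nth_uniq ?L3.
rewrite mem_iota => /andP[j3 _]; have [p q] := riii_pat i3 j3.
by rewrite /lkterm p q sgnE /sg (nth_map 0%N) ?L3.
Qed.

Lemma change_riii : change RIII (fun h => wsum h E - wsum h D).
Proof.
have /andP[_ /hasP[i0]] := riii_check; rewrite mem_iota => i03 /andP[di0 /allP others].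
have W h : wsum h E - wsum h D = h (gsgn D (f i0)) (lk D (f i0) + tri_delta w sg i0)
    - h (gsgn D (f i0)) (lk D (f i0)).
  have [R DR RL] := riii_split.
  rewrite /wsum (perm_big _ riii_crossings) -sumrB /= (perm_big _ DR) big_cat /=.
  rewrite [X in _ + X]big_seq [X in _ + X]big1 => [|c /RL cR]; last first.
    by rewrite riii_lk sgnE delta_out // addr0 subrr.
  rewrite addr0 -[f 0%N :: _]/(map f (iota 0 3)) big_map.
  rewrite (bigD1_seq i0) ?iota_uniq ?mem_iota //= big1_seq => [|i]; last first.
    move=> /andP[ii0 i3]; have /orP[/eqP i_i0|/eqP d0] := others i i3.
      by rewrite i_i0 eqxx in ii0.
    have {}i3 : (i < 3)%N by have : i \in iota 0 3 := i3; rewrite mem_iota.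
    by rewrite riii_lk sgnE delta_in // d0 addr0 subrr.
  by rewrite addr0 riii_lk sgnE delta_in.
move: di0 W; rewrite !inE => /pred2P[]-> W.
  by exists true, (gsgn D (f i0)), (lk D (f i0)) => h; rewrite W mul1r.
(* A drop by 1 is the opposite of a rise from the lower value. *)
exists false, (gsgn D (f i0)), (lk D (f i0) - 1) => h.
by rewrite W mulN1r subrK opprB.
Qed.
End DelRIII.

Lemma change_del k D E : wf D -> wf E -> del k D E ->
  change k (fun h => wsum h E - wsum h D).
Proof.
move=> wD wE; case: k; first exact: del_RI.
- move=> [sgnE [a [b [s1 [s2 [ab [defD [defE face]]]]]]]].
  exact: (@change_rii D E true a b s1 s2).
- move=> [sgnE [a [b [s1 [s2 [ab [defD [defE face]]]]]]]].
  exact: (@change_rii D E false a b s1 s2).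
move=> [sgnE [l1 [l2 [l3 [l4 [l5 [l6 [s1 [s2 [s3 [defD [defE [ov [sz face]]]]]]]]]]]]]].
have us : uniq [:: l1; l2; l3; l4; l5; l6].
  have := wf_uniq wD; rewrite defD (perm_uniq (perm_six_out _ _ _ _ _ _ _ _ _)) cat_uniq.
  by case/and3P.
have [L [w [uL L3 wT def_s mem_s]]] :=
  tri_label (s := [:: l1; l2; l3; l4; l5; l6]) erefl erefl us ov sz.
exact: (@change_riii D E l1 l2 l3 l4 l5 l6 s1 s2 s3 _ _ _ _ _ _ L w).
Qed.

Lemma change_step k D E : wf D -> wf E -> step k D E ->
  change k (fun h => wsum h E - wsum h D).
Proof.
move=> wD wE [D1 [E1 [isoD [isoE [/andP[wD1 _] [/andP[wE1 _] dels]]]]]].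
case: dels => /change_del c.
  apply: (changeN (changeN (c wD1 wE1) (fun h => erefl))) => h.
  by rewrite opprK (wsum_iso _ wD wD1) ?(wsum_iso _ wE wE1).
apply: (changeN (c wE1 wD1)) => h.
by rewrite opprB (wsum_iso _ wD wD1) ?(wsum_iso _ wE wE1).
Qed.

Local Close Scope ring_scope.

(** * Closures of 2-strand braids *)

Definition bar (l : letter) : letter := (l.1, ~~ l.2).

Definition twice (u : seq letter) : seq letter := u ++ map bar u.

(* All crossings of a 2-strand braid have the same flat picture, except that
   consecutive ones are met from alternate sides; the parity q records the side
   at the start of the word. *)
Fixpoint twisted (s : nat -> bool) (q : bool) (u : seq letter) : bool :=
  if u is l :: u' then (l.2 == (s l.1 == ~~ q)) && twisted s (~~ q) u' else true.

Lemma barK : involutive bar.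
Proof. by case=> c b; rewrite /bar /= negbK. Qed.

Lemma map_barK : involutive (map bar).
Proof. exact: mapK barK. Qed.

Lemma twisted_cat s q u v :
  twisted s q (u ++ v) = twisted s q u && twisted s (q (+) odd (size u)) v.
Proof.
elim: u q => [|l u IH] q /=; first by rewrite addbF.
by rewrite IH addNb addbN andbA.
Qed.

Lemma twisted_bar s q u : twisted s q (map bar u) = twisted s (~~ q) u.
Proof.
elim: u q => //= l u IH q; rewrite IH; congr (_ && _).
by case: (l.2); case: (s _); case: q.
Qed.

Lemma twisted_nth s q u i : twisted s q u -> i < size u ->
  (nth (0, false) u i).2 = (s (nth (0, false) u i).1 == ~~ (odd i (+) q)).
Proof.
elim: u q i => //= l u IH q [|i] /andP[/eqP lq /IH h] /=; first by rewrite lq.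
by move/h; rewrite addNb addbN.
Qed.

Section Faces.
Variables (D : gcode) (u : seq letter) (q : bool) (k : nat).
Hypotheses (defD : gword D = twice u) (uu : uniq (map fst u)).
Hypotheses (su : size u = k.*2.+1) (twu : twisted (gsgn D) q u).
Let m := k.*2.+1.
Let N := m.*2.

Ltac slia := unfold N, m in *; lia.

Lemma twice_size : gN D = N.
Proof. by rewrite /gN defD size_cat size_map su addnn. Qed.

Lemma twice_wf : wf D.
Proof.
apply/andP; split; rewrite defD.
  rewrite cat_uniq (map_uniq uu) /= map_inj_uniq ?(map_uniq uu) ?andbT; last exact: inv_inj barK.
  apply/hasPn => _ /mapP[l lu ->]; apply/negP => blu.
  have inj : {in u &, injective fst}.
    move=> x y /(nthP x)[i iu <-] /(nthP x)[j ju <-] fxy.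
    have : nth x.1 (map fst u) i == nth x.1 (map fst u) j.
      by rewrite !(nth_map x) ?fxy.
    by rewrite nth_uniq ?size_map // => /eqP ->.
  by have /(congr1 snd) := inj _ _ blu lu erefl; rewrite /bar /=; case: (l.2).
apply/allP => l; rewrite -[(l.1, _)]/(bar l) !mem_cat orbC => /orP[] lu; apply/orP.
  by left; case/mapP: lu => l' l'u ->; rewrite barK.
by right; apply: map_f.
Qed.

Lemma twice_ncross : ncross D = m.
Proof.
rewrite /ncross /crossings -[RHS]su -(size_map fst u); apply/perm_size/uniq_perm;
  rewrite ?undup_uniq //.
move=> c; rewrite mem_undup defD map_cat mem_cat -map_comp.
by rewrite (eq_map (g := fst)) ?orbb // => -[].
Qed.

Lemma lett_twice j : j < N -> lett D j =
  if j < m then nth (0, false) u j else bar (nth (0, false) u (j - m)).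
Proof.
move=> jN; rewrite /lett defD nth_cat su -/m; case: ifP => // jm.
by rewrite (nth_map (0, false)) // su -/m; slia.
Qed.

Lemma lett_opposite j : j < N -> lett D ((j + m) %% N) = bar (lett D j).
Proof.
move=> jN; have jN' : (j + m) %% N < N by rewrite ltn_pmod //; slia.
rewrite !lett_twice //; case: (ltnP j m) => jm.
  by rewrite modn_small; [rewrite ltnNge leq_addl addnK | slia].
have -> : j + m = (j - m) + N by slia.
by rewrite modnDr modn_small ?barK; [case: ifP => //; slia | slia].
Qed.

Lemma lett_twisted j : j < N ->
  (lett D j).2 = (gsgn D (lett D j).1 == ~~ (odd j (+) q)).
Proof.
move=> jN; rewrite lett_twice //; case: ifP => jm.
  by apply: (twisted_nth twu); rewrite su.
rewrite /= (twisted_nth twu) ?su //; last by slia.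
(* As [m] is odd, going [m] places back flips the parity, which matches the flip made by [bar]. *)
have -> : odd j = ~~ odd (j - m) by slia.
by case: (gsgn _ _); case: (odd (j - m)); case: q.
Qed.

Lemma partner_twice j : j < N -> partner D j = (j + m) %% N.
Proof.
move=> jN; rewrite /partner -[(_, ~~ _)]/(bar (lett D j)) -lett_opposite //.
rewrite index_uniq ?(wf_uniq twice_wf) // -/(gN D) twice_size ltn_pmod //; slia.
Qed.

(** [lett_twisted] ties over/under to the sign, so that only the parity survives in [dpos]: the
    faces do not depend on the crossing signs. *)
Lemma sigma_twice j (o : bool) : j < N ->
  sigma D (j.*2 + o) = ((j + m) %% N).*2 + (o (+) (odd j (+) q)).
Proof.
move=> jN; rewrite /sigma.
have -> : (j.*2 + o)./2 = j by slia.
have -> : odd (j.*2 + o) = o by slia.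
rewrite partner_twice // /dpos lett_opposite // /bar /= lett_twisted //.
case: (gsgn _ _); case: (odd j (+) q); case: o => /=; slia.
Qed.

Lemma odd_modN i : odd (i %% N) = odd i.
Proof. by rewrite {2}(divn_eq i N) oddD oddM /N odd_double andbF. Qed.

Lemma ltn_modN i : i %% N < N.
Proof. by rewrite ltn_pmod. Qed.

Lemma phi_twice j (o : bool) : j < N -> phi D (j.*2 + o) =
  if o then ((j.+1 + m) %% N).*2 + ~~ (odd j (+) q)
  else (((j + N).-1 + m) %% N).*2 + (odd j (+) q).
Proof.
move=> jN; have lt := ltn_modN; rewrite /phi /alpha twice_size.
have -> : (j.*2 + o)./2 = j by slia.
have -> : odd (j.*2 + o) = o by slia.
case: o.
  by rewrite -[_.*2]addn0 (sigma_twice false) // modnDml odd_modN /=; case: (odd j); case: q.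
rewrite -[_.*2.+1]addn1 (sigma_twice true) // modnDml odd_modN.
congr (_ + _); have -> : odd (j + N).-1 = ~~ odd j by slia.
by case: (odd j); case: q.
Qed.

(* The outgoing darts of the occurrences of parity q form one face and the
   incoming ones another; every other face is a bigon. *)
Lemma phi_even j (o : bool) : j < N -> odd j = q ->
  exists2 j', j' < N & odd j' = q /\ phi D (j.*2 + o) = j'.*2 + o.
Proof.
move=> jN jq; have lt := ltn_modN; rewrite phi_twice // jq addbb.
case: o; [exists ((j.+1 + m) %% N) => //| exists (((j + N).-1 + m) %% N) => //];
  split=> //; rewrite odd_modN; slia.
Qed.

Lemma phi2_even j (o : bool) : j < N -> odd j = q ->
  phi D (phi D (j.*2 + o)) = if o then ((j + 2) %% N).*2 + 1 else ((j + (N - 2)) %% N).*2.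
Proof.
move=> jN jq; have lt := ltn_modN; rewrite (phi_twice o) // jq addbb; case: o.
  rewrite (phi_twice true) // odd_modN.
  have -> : odd (j.+1 + m) (+) q = false by slia.
  have -> : ((j.+1 + m) %% N).+1 + m = (j.+1 + m) %% N + m.+1 by slia.
  rewrite modnDml; congr (_.*2 + _).
  have -> : j.+1 + m + m.+1 = j + 2 + N by slia.
  by rewrite modnDr.
rewrite (phi_twice false) // odd_modN.
have -> : odd ((j + N).-1 + m) (+) q = false by slia.
have -> : (((j + N).-1 + m) %% N + N).-1 + m = ((j + N).-1 + m) %% N + (N.-1 + m) by slia.
rewrite modnDml addn0; congr _.*2.
have -> : (j + N).-1 + m + (N.-1 + m) = j + (N - 2) + N + N by slia.
by rewrite !modnDr.
Qed.

Lemma phi2_odd j (o : bool) : j < N -> odd j = ~~ q -> phi D (phi D (j.*2 + o)) = j.*2 + o.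
Proof.
move=> jN jq; have lt := ltn_modN; rewrite (phi_twice o) // jq.
have -> : ~~ q (+) q = true by case: q.
case: o.
  rewrite (phi_twice false) // odd_modN.
  have -> : odd (j.+1 + m) (+) q = true by slia.
  have -> : ((j.+1 + m) %% N + N).-1 + m = (j.+1 + m) %% N + (N.-1 + m) by slia.
  rewrite modnDml; have -> : j.+1 + m + (N.-1 + m) = j + N + N by slia.
  by rewrite !modnDr modn_small.
rewrite (phi_twice true) // odd_modN.
have -> : odd ((j + N).-1 + m) (+) q = true by slia.
have -> : (((j + N).-1 + m) %% N).+1 + m = ((j + N).-1 + m) %% N + m.+1 by slia.
rewrite modnDml; have -> : (j + N).-1 + m + m.+1 = j + N + N by slia.
by rewrite !modnDr modn_small.
Qed.

Lemma iter_out j t : j < N -> odd j = q ->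
  iter t.*2 (phi D) (j.*2 + true) = ((j + t.*2) %% N).*2 + true.
Proof.
move=> jN jq; elim: t => [|t IH]; first by rewrite addn0 modn_small.
rewrite doubleS !iterS IH (phi2_even true) ?ltn_pmod ?odd_modN //; last slia.
by rewrite modnDml; congr ((_ %% _).*2 + _); lia.
Qed.

Lemma iter_in j t : j < N -> odd j = q -> t.*2 <= j ->
  iter t.*2 (phi D) (j.*2 + false) = (j - t.*2).*2 + false.
Proof.
move=> jN jq; elim: t => [|t IH] tj; first by rewrite subn0.
rewrite doubleS !iterS IH ?(phi2_even false) //; try slia.
have -> : j - t.*2 + (N - 2) = j - t.*2.+2 + N by slia.
rewrite modnDr modn_small ?addn0 //; slia.
Qed.

(** [nfaces] counts least darts. On a long face this is the dart at the first occurrence of parity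
    [q]; on a bigon it is the smaller of two. *)
Lemma face_min j (o : bool) : j < N ->
  all (fun i => j.*2 + o <= iter i (phi D) (j.*2 + o)) (iota 0 N.*2) =
  if odd j == q then j == q :> nat else if o then j.+1 < m else j <= m.
Proof.
move=> jN; case: eqVneq => jq.
  apply/allP/eqP => [h|jq' i _].
    case: o h => h.
      (* Outgoing darts move forward and must wrap around to reach occurrence [q]; incoming ones
         move backward and reach it after [j - q] steps. *)
      have := h (N - (j - q)); rewrite mem_iota /=.
      have -> : N - (j - q) = (m - (j - q)./2).*2 by slia.
      rewrite iter_out // => /(_ ltac:(slia)).
      have -> : j + (m - (j - q)./2).*2 = q + N by slia.
      rewrite modnDr modn_small; slia.
    have := h (j - q); rewrite mem_iota /=.
    have -> : j - q = (j - q)./2.*2 by slia.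
    rewrite iter_in //; last slia.
    move=> /(_ ltac:(slia)); slia.
  suff [j' j'N [j'q ->]] : exists2 j', j' < N & odd j' = q /\
      iter i (phi D) (j.*2 + o) = j'.*2 + o by slia.
  elim: i => [|i [j' j'N [j'q]]]; first by exists j.
  by rewrite iterS => ->; apply: phi_even.
have {}jq : odd j = ~~ q by move: jq; case: (odd j); case: (q).
have -> : all (fun i => j.*2 + o <= iter i (phi D) (j.*2 + o)) (iota 0 N.*2) =
    (j.*2 + o <= phi D (j.*2 + o)).
  apply/allP/idP => [/(_ 1)|h i _]; first by rewrite mem_iota; apply; slia.
  suff : iter i (phi D) (j.*2 + o) \in [:: j.*2 + o; phi D (j.*2 + o)].
    by rewrite !inE => /pred2P[]->.
  elim: i => [|i]; first by rewrite mem_head.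
  by rewrite iterS !inE => /pred2P[]->; rewrite ?phi2_odd // eqxx ?orbT.
rewrite phi_twice // jq; have -> : ~~ q (+) q = true by case: (q).
case: o.
  case: (ltnP j.+1 m) => jm.
    by rewrite modn_small; slia.
  have -> : j.+1 + m = (j.+1 - m) + N by slia.
  by rewrite modnDr modn_small; slia.
case: (leqP j m) => jm.
  have -> : (j + N).-1 + m = j + m.-1 + N by slia.
  by rewrite modnDr modn_small; slia.
have -> : (j + N).-1 + m = j - m.+1 + N + N by slia.
by rewrite !modnDr modn_small; slia.
Qed.

Lemma twice_nfaces : nfaces D = m + 2.
Proof.
rewrite /nfaces twice_size; set P := (X in count X _).
have Pmin j (o : bool) : j < N -> P (j.*2 + o) = _ := @face_min j o.
have Pfalse j d : d = j.*2 -> j < N -> P d = if odd j == q then j == q :> nat else j <= m.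
  by move=> -> /(Pmin j false); rewrite addn0.
have Ptrue j d : d = j.*2.+1 -> j < N -> P d = if odd j == q then j == q :> nat else j.+1 < m.
  by move=> -> /(Pmin j true); rewrite addn1.
(* Four darts at a time, at two occurrences of opposite parity. The first block holds the least
   darts of both long faces; bigons have an incoming least dart in the first [k.+1] blocks and an
   outgoing one in the first [k]. *)
suff count_min i : i <= m ->
    count P (iota 0 i.*2.*2) = (0 < i).*2 + minn i k.+1 + minn i k.
  by rewrite -/N count_min //; slia.
elim: i => [|i IH] im; first by rewrite /= !min0n.
have -> : i.+1.*2.*2 = i.*2.*2 + 4 by lia.
rewrite (iotaD 0 i.*2.*2 4) count_cat IH ?(ltnW im) // [count P (iota _ 4)]/= add0n.
have j0 : i.*2 < N by slia.
have j1 : i.*2.+1 < N by slia.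
rewrite (Pfalse _ _ (ltac:(lia) : i.*2.*2.+2 = i.*2.+1.*2) j1).
rewrite (Ptrue _ _ (ltac:(lia) : i.*2.*2.+3 = i.*2.+1.*2.+1) j1).
rewrite (Pfalse _ _ erefl j0) (Ptrue _ _ erefl j0) /= odd_double addn0.
clear Pmin Pfalse Ptrue IH.
by case: (q); rewrite /= ?eqxx /=; slia.
Qed.

Lemma twice_diagram : is_diagram D.
Proof. by rewrite /is_diagram twice_wf /planar twice_nfaces twice_ncross eqxx orbT. Qed.
End Faces.

Lemma find1 (P : pred nat) n : P 0 = false -> P 1 -> find P (iota 0 n.+2) = 1.
Proof. by move=> /= -> ->. Qed.

(** With starting parity [true], occurrence 0 does not have the parity of the long faces, so its
    outgoing dart borders a bigon, whose other edge leaves the opposite passage. *)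
Lemma twice_bigon D u k : gword D = twice u -> uniq (map fst u) ->
    size u = k.+1.*2.+1 -> twisted (gsgn D) true u ->
  bigon_face D 0 k.+1.*2.+1.
Proof.
move=> defD uu su twu; have szD := twice_size defD su.
have phi1 : phi D 1 = k.+1.*2.+2.*2.
  rewrite -[1]/(0.*2 + true) (phi_twice defD uu su twu true) /=; last lia.
  by rewrite add1n addn0 modn_small; lia.
have phi2 : phi D (phi D 1) = 1.
  by rewrite -{1}[1]/(0.*2 + true) (phi2_odd defD uu su twu) //; lia.
exists 1; split; first by rewrite szD; lia.
split.
  rewrite /face_len szD; have -> : k.+1.*2.+1.*2.*2 = (k.+1.*2.*2.*2 + 2).+2 by lia.
  by rewrite find1 //= ?phi2 // phi1; apply/negbTE; lia.
split=> //; rewrite phi1 /edge_of szD odd_double doubleK.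
have -> : (k.+1.*2.+2 + k.+1.*2.+1.*2).-1 = k.+1.*2.+1 + k.+1.*2.+1.*2 by lia.
by rewrite modnDr modn_small; lia.
Qed.

Definition braid_strand (s : nat -> bool) (m : seq nat) : seq letter :=
  [seq (i, odd i == s i) | i <- m].

(* The closure of the 2-strand braid with crossings 1, ..., m, crossing i being
   of sign s i; m is odd, so that the closure is a knot. *)
Definition braid (m : nat) (s : nat -> bool) : gcode :=
  GCode (twice (braid_strand s (iota 1 m))) s.

Lemma fst_braid_strand s r : map fst (braid_strand s r) = r.
Proof. by rewrite -map_comp map_id. Qed.

Lemma twisted_braid_strand s i n : twisted s (~~ odd i) (braid_strand s (iota i n)).
Proof.
elim: n i => //= n IH i; have /= -> := IH i.+1; rewrite andbT.
by case: (s i); case: (odd i).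
Qed.

Lemma braid_diagram k s : is_diagram (braid k.*2.+1 s).
Proof.
apply: (@twice_diagram _ (braid_strand s (iota 1 k.*2.+1)) false k) => //.
- by rewrite fst_braid_strand iota_uniq.
- by rewrite size_map size_iota.
- exact: (twisted_braid_strand s 1).
Qed.

Lemma iso_rot D k : iso D (GCode (rot k (gword D)) (gsgn D)).
Proof. by exists id, k; split=> //=; rewrite map_id_in // => -[]. Qed.

Definition skip2 (p i : nat) : nat := if i < p then i else i.+2.

(** From [p] to [p.+1] both the sign and the parity flip, so the same strand is over at the two
    crossings and their bigon can be cancelled. *)
Lemma step_braid k s t p : 0 < p <= k.+1.*2 -> s p = false -> s p.+1 = true ->
    (forall i, 0 < i <= k.*2.+1 -> t i = s (skip2 p i)) ->
  step RIIm (braid k.+1.*2.+1 s) (braid k.*2.+1 t).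
Proof.
move=> /andP[p0 pk] sp sp1 ts.
pose u1 := braid_strand s (iota 1 p.-1).
pose u2 := braid_strand s (iota p.+2 (k.+1.*2 - p)).
have strandE : braid_strand s (iota 1 k.+1.*2.+1) =
    u1 ++ [:: (p, ~~ odd p); (p.+1, ~~ odd p)] ++ u2.
  have -> : k.+1.*2.+1 = p.-1 + (k.+1.*2 - p).+2 by lia.
  rewrite iotaD /braid_strand map_cat -/(braid_strand s _); congr (_ ++ _).
  have -> : 1 + p.-1 = p by lia.
  by rewrite /= sp sp1 /=; case: (odd p).
have strandtE : map (relabel (skip2 p)) (braid_strand t (iota 1 k.*2.+1)) = u1 ++ u2.
  have -> : k.*2.+1 = p.-1 + (k.+1.*2 - p) by lia.
  rewrite iotaD /braid_strand !map_cat -!map_comp; congr (_ ++ _).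
    apply/eq_in_map => i; rewrite mem_iota => ip; rewrite /relabel /= ts; last lia.
    by rewrite /skip2; case: ifP => //; lia.
  have -> : 1 + p.-1 = p by lia.
  rewrite /u2 /braid_strand -[p.+2]/(2 + p) iotaDl -map_comp.
  apply/eq_in_map => i; rewrite mem_iota => ip; rewrite /relabel /= ts; last lia.
  by rewrite /skip2; case: ifP => //; [lia | rewrite /= negbK].
(* The word must start with the over strand of the bigon: it is met on the second pass along the
   braid if [p] is odd, on the first if [p] is even. *)
pose v := if odd p then map bar u2 ++ u1 else u2 ++ map bar u1.
pose a := [:: (p, true); (p.+1, true)].
have sz1 : size u1 = p.-1 by rewrite size_map size_iota.
have sz2 : size u2 = k.+1.*2 - p by rewrite size_map size_iota.
have szv : size v = k.*2.+1.
  by rewrite /v; case: ifP; rewrite size_cat size_map sz1 sz2; lia.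
have uniqv : uniq (map fst (a ++ v)).
  have : uniq (map fst (braid_strand s (iota 1 k.+1.*2.+1))).
    by rewrite fst_braid_strand iota_uniq.
  rewrite strandE; apply: etrans; apply/esym/perm_uniq/permP => P.
  have barP u : map fst (map bar u) = map fst u by rewrite -map_comp; apply: eq_map => -[].
  rewrite /v !map_cat !count_cat; case: (odd p);
  by rewrite map_cat barP count_cat /=; lia.
have tw1 : twisted s false u1 := twisted_braid_strand s 1 _.
have tw2 : twisted s (~~ odd p) u2.
  by have := twisted_braid_strand s p.+2 (k.+1.*2 - p); rewrite /= negbK.
have twv : twisted s true v.
  rewrite /v; case: ifP tw2 => op tw2; rewrite twisted_cat ?twisted_bar tw2 /=.
    by rewrite size_map sz2; have -> : odd (k.+1.*2 - p) = true by lia.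
  by rewrite sz2; have -> : odd (k.+1.*2 - p) = false by lia.
have [i rotD] : exists i, twice (a ++ v) = rot i (gword (braid k.+1.*2.+1 s)).
  rewrite -[gword _]/(twice (braid_strand s (iota 1 k.+1.*2.+1))) strandE /v /a; case: ifP => op.
    exists (size (u1 ++ [:: (p, false); (p.+1, false)] ++ u2 ++ map bar u1)).
    rewrite /twice !map_cat !map_barK.
    have -> : (u1 ++ [:: (p, false); (p.+1, false)] ++ u2) ++
        map bar u1 ++ map bar [:: (p, false); (p.+1, false)] ++ map bar u2 =
      (u1 ++ [:: (p, false); (p.+1, false)] ++ u2 ++ map bar u1) ++
        [:: (p, true); (p.+1, true)] ++ map bar u2.
      by rewrite -!catA.
    by rewrite rot_size_cat -!catA.
  exists (size u1); rewrite /twice !map_cat !map_barK -!catA.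
  by rewrite rot_size_cat -!catA.
have [j rotE] : exists j, twice v =
    rot j (map (relabel (skip2 p)) (gword (braid k.*2.+1 t))).
  have -> : map (relabel (skip2 p)) (gword (braid k.*2.+1 t)) = twice (u1 ++ u2).
    by rewrite -strandtE /twice !map_cat -!map_comp.
  rewrite /v; case: ifP => op.
    exists (size (u1 ++ u2 ++ map bar u1)); rewrite /twice !map_cat map_barK.
    have -> : (u1 ++ u2) ++ map bar u1 ++ map bar u2 = (u1 ++ u2 ++ map bar u1) ++ map bar u2.
      by rewrite -!catA.
    by rewrite rot_size_cat -!catA.
  exists (size u1); rewrite /twice !map_cat map_barK -!catA.
  by rewrite rot_size_cat -!catA.
have sza : size (a ++ v) = k.+1.*2.+1 by rewrite size_cat szv.
have twa : twisted s true (a ++ v) by rewrite /= sp sp1.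
exists (GCode (twice (a ++ v)) s), (GCode (twice v) s); split; last split; last split; last split.
- by rewrite rotD; apply: iso_rot.
- exists (skip2 p), j; split=> [|c]; first exact: rotE.
  rewrite /= mem_undup map_cat mem_cat fst_braid_strand -map_comp -[map (fst \o bar) _]/(map fst _).
  by rewrite fst_braid_strand orbb mem_iota => cp; rewrite ts //; lia.
- exact: (@twice_diagram _ (a ++ v) true k.+1).
- apply: (@twice_diagram _ v true k) => //.
  by move: uniqv; rewrite map_cat cat_uniq => /and3P[].
left; split=> //; exists p, p.+1, v, (map bar v); split; first by rewrite neq_ltn ltnSn.
split; first by [].
by split=> //; rewrite szv; apply: (@twice_bigon _ (a ++ v) k).
Qed.

(** * The explicit sequence from $D_n$ to $E_n$ through the round circle *)

Lemma Dn_braid n : Dn n = braid n.*2.+1 (Dsgn n).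
Proof.
rewrite /Dn /braid /twice /braid_strand -map_comp; congr (GCode (_ ++ _) _).
Qed.

Definition Esgn (n i : nat) : bool := if i == n.+1 then ~~ Dsgn n i else Dsgn n i.

Lemma EsgnE n i : Esgn n i = (n < i).
Proof. by rewrite /Esgn /Dsgn; case: eqP => [->|]; lia. Qed.

Lemma En_braid n : En n = braid n.*2.+1 (Esgn n).
Proof.
rewrite /En /braid -/(Esgn n); congr GCode; rewrite Dn_braid /twice !map_cat -!map_comp.
by congr (_ ++ _); apply: eq_map => i; rewrite /bar /Esgn /=; case: eqP => // _;
  case: (odd i); case: (Dsgn n i).
Qed.

Lemma step_sym k D E : step k D E -> step k E D.
Proof.
by case=> D1 [E1 [? [? [? [? []]]]]] d; exists E1, D1; do 4 (split=> //); [right|left].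
Qed.

Definition empty_code : gcode := GCode [::] (fun=> false).

Lemma step_kink s : step RI (braid 1 s) empty_code.
Proof.
exists (braid 1 s), (GCode [::] s); split.
  by exists id, 0; split; rewrite ?rot0 // map_id_in // => -[].
split; first by exists id, 0.
split; first exact: (braid_diagram 0).
split=> //; left; split=> //; exists 1, (true == s 1), [::]; split=> //.
Qed.

Lemma steps_ok_cat P D s1 s2 :
  steps_ok P D (s1 ++ s2) <-> steps_ok P D s1 /\ steps_ok P (rend D s1) s2.
Proof.
elim: s1 D => [|[k G] s1 IH] D /=; first by split=> [|[]].
by rewrite IH; split=> [[? [? ?]]|[[? ?] ?]].
Qed.

Lemma rend_cat D s1 s2 : rend D (s1 ++ s2) = rend (rend D s1) s2.
Proof. by rewrite /rend map_cat last_cat. Qed.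

Lemma Dn_diagram n : is_diagram (Dn n).
Proof. by rewrite Dn_braid; apply: braid_diagram. Qed.

Lemma En_diagram n : is_diagram (En n).
Proof. by rewrite En_braid; apply: braid_diagram. Qed.

Lemma Dn_to_empty n :
  exists s, [/\ rpath (Dn n) s, rend (Dn n) s = empty_code & size s = n.+1].
Proof.
elim: n => [|n [s [ps es ss]]].
  exists [:: (RI, empty_code)]; split=> //=; split=> //; split=> //.
  by rewrite Dn_braid; apply: step_kink.
exists ((RIIm, Dn n) :: s); split=> //=; last by rewrite ss.
split=> //; split; first exact: Dn_diagram.
(* [n.+2] is the last negative crossing of $D_{n+1}$. *)
rewrite !Dn_braid; apply: (@step_braid n _ _ n.+2); rewrite /Dsgn ?ltnSn ?ltnn //; first lia.
by move=> i _; rewrite /skip2; case: ifP; lia.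
Qed.

Lemma empty_to_En n :
  exists s, [/\ rpath empty_code s, rend empty_code s = En n & size s = n.+1].
Proof.
elim: n => [|n [s [ps es ss]]].
  exists [:: (RI, En 0)]; split=> //=; split=> //; split; first exact: En_diagram.
  by rewrite En_braid; apply/step_sym/step_kink.
exists (s ++ [:: (RIIm, En n.+1)]); split; last 2 first.
- by rewrite rend_cat.
- by rewrite size_cat ss addn1.
apply/steps_ok_cat; rewrite es; do 2 (split=> //); split; first exact: En_diagram.
(* $E_{n+1}$ has only [n.+1] negative crossings, and here the move creates the bigon. *)
rewrite !En_braid; apply/step_sym/(@step_braid n _ _ n.+1);
  rewrite ?EsgnE ?ltnSn ?ltnn //; first lia.
by move=> i _; rewrite !EsgnE /skip2; case: ifP; lia.
Qed.

(** * Linking numbers in the diagrams $D_n$ and $E_n$ *)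

Lemma braid_crossings m s : perm_eq (crossings (braid m s)) (iota 1 m).
Proof.
apply: uniq_perm; rewrite ?crossings_uniq ?iota_uniq // => c.
rewrite mem_undup map_cat mem_cat -[map fst (map bar _)]map_comp.
by rewrite -[map (fst \o bar) _]/(map fst _) fst_braid_strand orbb.
Qed.

(** Any two crossings of the closure interleave in the word, so exactly one of them counts in the
    smoothing at the other; which one depends on whether the same pass is over at both. *)
Lemma braid_pat_lt m s i d : 0 < i -> i < d -> d <= m ->
  let o j := odd j == s j in
  pat (gword (braid m s)) i d = (o i != o d) /\
  pat (gword (braid m s)) d i = (o i == o d).
Proof.
move=> i0 id dm o.
have fiota : [seq j <- iota 1 m | j \in [:: i; d]] = [:: i; d].
  apply: (irr_sorted_eq ltn_trans ltnn); rewrite ?sorted_filter ?iota_ltn_sorted ?/= ?id //.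
    exact: ltn_trans.
  move=> j; rewrite mem_filter mem_iota; case: (boolP (j \in _)) => //.
  by rewrite !inE => /pred2P[]->; lia.
have uL : uniq [:: i; d] by rewrite /= inE andbT; lia.
pose C : seq letter := [:: (0, o i); (1, o d); (0, ~~ o i); (1, ~~ o d)].
have fw : [seq l <- gword (braid m s) | l.1 \in [:: i; d]] = map (relabel (nth 0 [:: i; d])) C.
  rewrite filter_cat /braid_strand -map_comp !filter_map.
  by rewrite (eq_filter (a2 := fun j => j \in [:: i; d])) // fiota.
have pF a b : a \in [:: i; d] -> b \in [:: i; d] -> pat (gword (braid m s)) a b =
    pat (map (relabel (nth 0 [:: i; d])) C) a b.
  by move=> aL bL; rewrite -fw pat_filter.
have q1 := pat_nth (C := C) (i := 0) (j := 1) uL erefl erefl erefl.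
have q2 := pat_nth (C := C) (i := 1) (j := 0) uL erefl erefl erefl.
split; rewrite pF ?inE ?eqxx ?orbT //; [apply: etrans q1 _|apply: etrans q2 _];
  by rewrite /C; case: (o i); case: (o d).
Qed.

Local Open Scope ring_scope.

Lemma sum_parity (e : bool) (z : int) a n :
  \sum_(d <- iota a n) (if odd d == e then z else 0) = z *+ (n + (odd a == e))./2.
Proof.
elim: n a => [|n IH] a; first by rewrite big_nil; case: (_ == _).
rewrite big_cons {}IH /=; case: (odd a); case: e; rewrite /= ?add0r ?addn0 ?addn1 //;
  by rewrite -mulrS.
Qed.

Lemma braid_lk m s i : (0 < i <= m)%N ->
  lk (braid m s) i =
    \sum_(d <- iota 1 i.-1) (if odd d == s d == (odd i == s i) then sgnz (s d) else 0) +
    \sum_(d <- iota i.+1 (m - i)) (if odd d == s d != (odd i == s i) then sgnz (s d) else 0).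
Proof.
move=> /andP[i0 im]; rewrite lkE (perm_big _ (braid_crossings m s)).
have -> : iota 1 m = iota 1 i.-1 ++ i :: iota i.+1 (m - i).
  rewrite {1}(_ : m = (i.-1 + (m - i).+1)%N); last lia.
  by rewrite iotaD; have -> : (1 + i.-1 = i)%N by lia.
rewrite big_cat big_cons eqxx /=; congr (_ + _); rewrite big_mkcond; apply: eq_big_seq => d;
  rewrite mem_iota /lkterm => dP.
  have -> : d != i by lia.
  by rewrite (braid_pat_lt s (i := d) (d := i) (m := m) _ _ _).2 //; lia.
have -> : d != i by lia.
by rewrite (braid_pat_lt s (i := i) (d := d) (m := m) _ _ _).1 1?eq_sym //; lia.
Qed.

Lemma sum_parity_in (F : nat -> int) (e : bool) (z : int) a n :
    (forall d, (a <= d < a + n)%N -> F d = if odd d == e then z else 0) ->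
  \sum_(d <- iota a n) F d = z *+ (n + (odd a == e))./2.
Proof.
by move=> FE; rewrite -sum_parity; apply: eq_big_seq => d; rewrite mem_iota => /FE.
Qed.

(** The other crossings form three runs of constant sign: before [i], from [i] to [p], and after
    [p]. Along each run every second crossing counts, hence the halves. *)
Lemma braid_lk_neg m p s i : (forall j, s j = (p < j)%N) -> (0 < i <= p)%N -> (p <= m)%N ->
  lk (braid m s) i = - ((i.-1 + odd i)./2)%:Z - ((p - i).+1./2)%:Z
                     + ((m - p + (odd p.+1 == odd i))./2)%:Z.
Proof.
move=> sE ip pm; rewrite braid_lk; last lia.
rewrite (sum_parity_in (e := odd i) (z := -1)); last first.
  by move=> d dP; rewrite !sE; case: (odd d); case: (odd i); do 2 (case: ltnP => ? //=); lia.
have -> : (m - i = (p - i) + (m - p))%N by lia.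
rewrite iotaD big_cat /= (sum_parity_in (e := ~~ odd i) (z := -1)); last first.
  by move=> d dP; rewrite !sE; case: (odd d); case: (odd i); do 2 (case: ltnP => ? //=); lia.
rewrite (sum_parity_in (e := odd i) (z := 1)); last first.
  by move=> d dP; rewrite !sE; case: (odd d); case: (odd i); do 2 (case: ltnP => ? //=); lia.
have -> : (i.+1 + (p - i) = p.+1)%N by lia.
rewrite eqxx addn1 !mulNrn -addrA; congr (- _ + (- _ + _)); rewrite ?natz //.
Qed.

Lemma braid_lk_pos m p s i : (forall j, s j = (p < j)%N) -> (p < i <= m)%N ->
  lk (braid m s) i = - ((p + ~~ odd i)./2)%:Z + ((i.-1 - p + (odd p.+1 == odd i))./2)%:Z
                     + ((m - i).+1./2)%:Z.
Proof.
move=> sE ip; rewrite braid_lk; last lia.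
have -> : (i.-1 = p + (i.-1 - p))%N by lia.
rewrite iotaD big_cat /= (sum_parity_in (e := ~~ odd i) (z := -1)); last first.
  by move=> d dP; rewrite !sE; case: (odd d); case: (odd i); do 2 (case: ltnP => ? //=); lia.
rewrite (sum_parity_in (e := odd i) (z := 1)); last first.
  by move=> d dP; rewrite !sE; case: (odd d); case: (odd i); do 2 (case: ltnP => ? //=); lia.
rewrite (sum_parity_in (e := ~~ odd i) (z := 1)); last first.
  by move=> d dP; rewrite !sE; case: (odd d); case: (odd i); do 2 (case: ltnP => ? //=); lia.
have -> : (p + (i.-1 - p) - p = i.-1 - p)%N by lia.
rewrite eqxx addn1 mulNrn !natz add1n; congr (- _ + _ + _).
Qed.

Lemma braid_wsum h m p s k0 k1 : (p <= m)%N -> (forall j, s j = (p < j)%N) ->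
    (forall i, (0 < i <= p)%N -> lk (braid m s) i = k0) ->
    (forall i, (p < i <= m)%N -> lk (braid m s) i = k1) ->
  wsum h (braid m s) = h false k0 *+ p + h true k1 *+ (m - p).
Proof.
move=> pm sE l0 l1; rewrite /wsum (perm_big _ (braid_crossings m s)) -{1}(subnKC pm).
rewrite iotaD big_cat /=; congr (_ + _).
  rewrite (eq_big_seq (fun=> h false k0)) => [|i]; last first.
    by rewrite mem_iota => ip; rewrite l0 ?sE; [case: ltnP => //|]; lia.
  by rewrite big_const_seq count_predT size_iota iter_addr addr0.
rewrite (eq_big_seq (fun=> h true k1)) => [|i]; last first.
  by rewrite mem_iota => ip; rewrite l1 ?sE; [case: ltnP => //|]; lia.
by rewrite big_const_seq count_predT size_iota iter_addr addr0.
Qed.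

Lemma Dn_wsum h n : wsum h (Dn n) = h false 0 *+ n.+1 + h true (-1) *+ n.
Proof.
have sE j : Dsgn n j = (n.+1 < j)%N by [].
rewrite Dn_braid (@braid_wsum h _ n.+1 _ 0 (-1)) //.
- by congr (_ + _ *+ _); lia.
- lia.
- by move=> i ip; rewrite (braid_lk_neg sE) //; lia.
- by move=> i ip; rewrite (braid_lk_pos sE) //; lia.
Qed.

Lemma En_wsum h n : wsum h (En n) = h false 1 *+ n + h true 0 *+ n.+1.
Proof.
have sE := EsgnE n.
rewrite En_braid (@braid_wsum h _ n _ 1 0) //.
- by congr (_ + _ *+ _); lia.
- lia.
- by move=> i ip; rewrite (braid_lk_neg sE) //; lia.
- by move=> i ip; rewrite (braid_lk_pos sE) //; lia.
Qed.

(** * Sequences of moves *)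

Lemma steps_ok_impl (P Q : mkind -> gcode -> gcode -> Prop) D s :
  (forall k D G, P k D G -> Q k D G) -> steps_ok P D s -> steps_ok Q D s.
Proof.
by move=> PQ; elim: s D => //= -[k G] s IH D [/PQ ? /IH].
Qed.

Lemma steps_ok_and (P Q : mkind -> gcode -> gcode -> Prop) D s :
  steps_ok P D s -> steps_ok Q D s -> steps_ok (fun k D G => P k D G /\ Q k D G) D s.
Proof.
by elim: s D => //= -[k G] s IH D [? p] [? q]; split=> //; apply: IH.
Qed.

Lemma rpath_change D s : is_diagram D -> rpath D s ->
  steps_ok (fun k D G => change k (fun h => wsum h G - wsum h D)) D s.
Proof.
elim: s D => //= -[k G] s IH D dD [[dG st] /IH]; split; last by auto.
by apply: change_step st; [case/andP: dD | case/andP: dG].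
Qed.

Lemma telescope_le (v : gcode -> int) D s :
    steps_ok (fun _ D G => v G - v D <= 1) D s ->
  v (rend D s) - v D <= (size s)%:Z.
Proof.
elim: s D => [|[k G] s IH] D /=; first by rewrite /rend /= subrr.
by case=> vG /IH; rewrite -[rend D _]/(rend G s); lia.
Qed.

Lemma telescope_eq (v : gcode -> int) D s :
    steps_ok (fun _ D G => v G - v D <= 1) D s ->
    v (rend D s) - v D = (size s)%:Z ->
  steps_ok (fun _ D G => v G - v D = 1) D s.
Proof.
elim: s D => [|[k G] s IH] D //= [vG vs]; rewrite -[rend D _]/(rend G s).
have := telescope_le vs => le eq; split; last apply: IH => //; lia.
Qed.

Lemma telescope_count (v : gcode -> int) (a : pred mkind) D s :
    steps_ok (fun k D G => v G - v D = (a k)%:Z) D s ->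
  v (rend D s) - v D = (count (fun p => a p.1) s)%:Z.
Proof.
elim: s D => [|[k G] s IH] D /=; first by rewrite /rend /= subrr.
by case=> vG /IH; rewrite -[rend D _]/(rend G s); lia.
Qed.

Lemma steps_ok_all (a : pred mkind) D s :
  steps_ok (fun k _ _ => a k) D s -> all (fun p => a p.1) s.
Proof. by elim: s D => //= -[k G] s IH D [-> /IH]. Qed.

(* The first weight alone would also allow the RIII moves replacing X_1 by X_0 or
   Y_0 by Y_(-1), the second one alone some unmatched RII moves. *)
Definition peak_weight (e : bool) (k : int) : int := if k == 0 then sgnz e else 0.
Definition half_weight (e : bool) (k : int) : int :=
  if e then (if 0 <= k then 1 else 0) else (if k <= 0 then -1 else 0).

(** In both weights the $X$ terms weigh 0 or 1 and the $Y$ terms -1 or 0, so the sum in an RII move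
    and the difference in an RIII move stay between -1 and 1. *)
Lemma change_le1 k F : change k F -> F peak_weight <= 1 /\ F half_weight <= 1.
Proof.
case: k => /=.
- by move=> [t [e FE]]; rewrite !FE; case: (t); case: (e).
- move=> [t [m FE]]; rewrite !FE /peak_weight /half_weight.
  by case: (t); rewrite /sgnz; split; do ?case: ifP; lia.
- move=> [t [m FE]]; rewrite !FE /peak_weight /half_weight.
  by case: (t); rewrite /sgnz; split; do ?case: ifP; lia.
move=> [t [e [m FE]]]; rewrite !FE /peak_weight /half_weight.
by case: (t); case: (e); rewrite /sgnz; split; do ?case: ifP; lia.
Qed.

(** The peak weight of $X_m + Y_m$ is always 0, which excludes unmatched RII. For RI, a gain of 1
    means that the crossing created or removed has the sign that raises the writhe. *)
Lemma change_extremal k F : change k F -> F peak_weight = 1 -> F half_weight = 1 ->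
  [/\ ~~ isRIIu k, F (fun e _ => sgnz e) = (isRI k)%:Z &
   isRI k = false -> exists g : GZ,
    (g = gadd (Xg 0) (Yg 1) \/ g = gopp (gadd (Xg (-1)) (Yg 0)) \/
     g = gadd (Xg 0) (gopp (Xg (-1))) \/ g = gadd (Yg 1) (gopp (Yg 0))) /\
    forall b m, F (fun e k => gbas b m e k) = g b m].
Proof.
(* By this symmetry, evaluating [F] at a basis function reads off a coefficient of the change. *)
have gbasC b m e k0 : gbas b m e k0 = gbas e k0 b m.
  by rewrite /gbas (eq_sym e) (eq_sym k0).
case: k => /=.
- by move=> [t [e FE]]; rewrite !FE; case: (t); case: (e).
- move=> [t [m FE]]; rewrite !FE /peak_weight /half_weight /sgnz => h1 h2.
  split=> //; first by case: (t); rewrite ?mul1r ?mulN1r; lia.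
  move=> _; case: t FE h1 h2 => FE h1 h2.
    have m0 : m = 0 by move: h1 h2; do ?case: ifP; lia.
    exists (gadd (Xg 0) (Yg 1)); split; first by left.
    by move=> b n; rewrite FE m0 mul1r add0r /gadd /Xg /Yg !(gbasC b n).
  have m0 : m = -1 by move: h1 h2; do ?case: ifP; lia.
  exists (gopp (gadd (Xg (-1)) (Yg 0))); split; first by right; left.
  by move=> b n; rewrite FE m0 mulN1r addNr /gopp /gadd /Xg /Yg !(gbasC b n).
- move=> [t [m FE]]; rewrite !FE /peak_weight /sgnz => h1.
  by move: h1; case: (t); do ?case: ifP; lia.
move=> [t [e [m FE]]]; rewrite !FE /peak_weight /half_weight /sgnz => h1 h2.
split=> //; first by rewrite subrr mulr0.
have [m0 te] : m = (if e then -1 else 0) /\ t.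
  by move: h1 h2; case: (t); case: (e); do ?case: ifP; lia.
move: FE; rewrite m0 te; case: (e) => FE _.
  exists (gadd (Xg 0) (gopp (Xg (-1)))); split; first by do 2 right; left.
  by move=> b n; rewrite FE mul1r addNr /gadd /gopp /Xg !(gbasC b n).
exists (gadd (Yg 1) (gopp (Yg 0))); split; first by do 3 right.
by move=> b n; rewrite FE mul1r add0r /gadd /gopp /Yg !(gbasC b n).
Qed.

Local Close Scope ring_scope.

Theorem theorem2 (n : nat) (hn : 1 <= n) :
  (* a sequence of 2n+2 Reidemeister moves from D_n to E_n exists *)
  (exists s, rpath (Dn n) s /\ rend (Dn n) s = En n /\ size s = n.*2 + 2) /\
  (* no shorter sequence exists *)
  (forall s, rpath (Dn n) s -> rend (Dn n) s = En n -> n.*2 + 2 <= size s) /\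
  (* structure of the minimal sequences *)
  (forall s, rpath (Dn n) s -> rend (Dn n) s = En n -> size s = n.*2 + 2 ->
     count (fun p => isRI p.1) s = 2 /\
     steps_ok (fun k D G => isRI k = false -> ilk_change_ok D G) (Dn n) s /\
     all (fun p => ~~ isRIIu p.1) s).
Proof.
have gap_peak : (wsum peak_weight (En n) - wsum peak_weight (Dn n) = (n.*2 + 2)%:Z)%R.
  by rewrite Dn_wsum En_wsum /peak_weight /= /sgnz; lia.
have gap_half : (wsum half_weight (En n) - wsum half_weight (Dn n) = (n.*2 + 2)%:Z)%R.
  by rewrite Dn_wsum En_wsum /half_weight /=; lia.
have gap_sign : (wsum (fun e _ => sgnz e) (En n) - wsum (fun e _ => sgnz e) (Dn n) = 2)%R.
  by rewrite Dn_wsum En_wsum /sgnz; lia.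
have steps_le s : rpath (Dn n) s ->
    steps_ok (fun _ D G => wsum peak_weight G - wsum peak_weight D <= 1)%R (Dn n) s /\
    steps_ok (fun _ D G => wsum half_weight G - wsum half_weight D <= 1)%R (Dn n) s.
  move=> /(rpath_change (Dn_diagram n)) cs.
  by split; apply: steps_ok_impl cs => k D G /change_le1[].
split; last split.
- have [s1 [p1 e1 z1]] := Dn_to_empty n; have [s2 [p2 e2 z2]] := empty_to_En n.
  exists (s1 ++ s2); split; first by apply/steps_ok_cat; rewrite e1.
  by rewrite rend_cat e1 e2 size_cat z1 z2; split=> //; lia.
- move=> s /steps_le[/telescope_le + _] es.
  by rewrite es gap_peak.
move=> s ps es sz; have [le_peak le_half] := steps_le s ps.
have := telescope_eq le_peak; have := telescope_eq le_half.
rewrite es sz gap_peak gap_half => /(_ erefl) eq_half /(_ erefl) eq_peak.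
have ext : steps_ok (fun k D G =>
    [/\ ~~ isRIIu k,
     (wsum (fun e _ => sgnz e) G - wsum (fun e _ => sgnz e) D = (isRI k)%:Z)%R &
     isRI k = false -> ilk_change_ok D G]) (Dn n) s.
  have := steps_ok_and (rpath_change (Dn_diagram n) ps) (steps_ok_and eq_peak eq_half).
  apply: steps_ok_impl => k D G [ch [e1 e2]].
  have [? ? gk] := change_extremal ch e1 e2; split=> // /gk[g [gg Fg]].
  by exists g; split=> // b m; rewrite !Ilk_wsum.
split; [|split].
- have /telescope_count : steps_ok (fun k D G =>
      (wsum (fun e _ => sgnz e) G - wsum (fun e _ => sgnz e) D = (isRI k)%:Z)%R) (Dn n) s.
    by apply: steps_ok_impl ext => k D G [].
  by rewrite es gap_sign => -[].
- by apply: steps_ok_impl ext => k D G [].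
by apply: (@steps_ok_all (fun k => ~~ isRIIu k)); apply: steps_ok_impl ext => k D G [].
Qed.
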